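(* Let $\mathbb{K}$ be a field, $R=\mathbb{K}[x_1,\ldots,x_n]$, and let $I\subseteq R$ be a support-two monomial ideal with base graph $G_I$. If $I$ is componentwise linear, then the complement $(G_I)^c$ of $G_I$ is chordal (equivalently, $\sqrt{I}$ has a linear resolution).
   Context: $R=\mathbb{K}[x_1,\ldots,x_n]$ has the standard grading. For a monomial ideal $I$, $\mathcal{G}(I)$ is its minimal set of monomial generators; for a monomial $u$, $\operatorname{supp}(u)$ is the set of variables dividing $u$. A monomial ideal $I$ is a support-two monomial ideal if $|\operatorname{supp}(u)|=2$ for every $u\in\mathcal{G}(I)$. Several generators may have the same support. The base graph $G_I$ of a support-two monomial ideal $I$ is the simple graph on the variables in which $\{x_i,x_j\}$ is an edge iff $\{x_i,x_j\}=\operatorname{supp}(u)$ for some $u\in\mathcal{G}(I)$; equivalently $\sqrt{I}=I(G_I)$, where $I(G)=(x_ix_j\mid\{x_i,x_j\}\in E(G))$ is the edge ideal of $G$. A nonzero graded ideal $I$ has a linear resolution if $\operatorname{reg}(I)=\alpha(I)$, where $\operatorname{reg}$ is Castelnuovo-Mumford regularity and $\alpha(I)$ is the minimum degree of a nonzero homogeneous element of $I$. A graded ideal $I$ is componentwise linear if for each $d\ge 0$ the ideal $I_{\langle d\rangle}$ generated by all homogeneous elements of degree $d$ in $I$ has a linear resolution (or is zero). A simple graph is chordal if it has no induced cycle of length greater than three. The complement $G^c$ of $G$ has the same vertex set, and its edges are exactly the pairs of distinct vertices that are non-edges of $G$. *)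

(* Defs.v *)
From HB Require Import structures.
From mathcomp Require Import all_boot all_order all_algebra.
From mathcomp Require Import mpoly.

Set Implicit Arguments.
Unset Strict Implicit.
Unset Printing Implicit Defensive.

Import Order.TTheory GRing.Theory Num.Theory.
Local Open Scope ring_scope.

Section Ideals.
Variables (K : fieldType) (n : nat).
Implicit Types (I J : {mpoly K[n]} -> Prop) (f g : {mpoly K[n]}).

Definition is_ideal I : Prop :=
  [/\ I 0, forall f g, I f -> I g -> I (f + g) & forall f g, I g -> I (f * g)].

Definition ideal_gen (S : {mpoly K[n]} -> Prop) : {mpoly K[n]} -> Prop :=
  fun f => exists2 s : seq ({mpoly K[n]} * {mpoly K[n]}),
    forall p, p \in s -> S p.2 & f = \sum_(p <- s) p.1 * p.2.

Definition nonzero_ideal I : Prop := exists2 f, I f & f != 0.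

Definition radical I : {mpoly K[n]} -> Prop := fun f => exists k, I (f ^+ k).

Definition graded_ideal I : Prop :=
  is_ideal I /\ forall f d, I f -> I (pihomog mdeg d f).

Definition initial_degree I (m : nat) : Prop :=
  (exists f, [/\ I f, f != 0 & f \is m.-homog]) /\
  (forall f d, I f -> f != 0 -> f \is d.-homog -> (m <= d)%N).

Definition degree_component_ideal I (d : nat) : {mpoly K[n]} -> Prop :=
  ideal_gen (fun f => I f /\ f \is d.-homog).

End Ideals.

Section Resolutions.
Variables (K : fieldType) (n : nat).

(* Membership in the graded piece R_d, d an integer; R_d = 0 for d < 0. *)
Definition in_degree (d : int) (f : {mpoly K[n]}) : Prop :=
  if d is Posz e then f \is e.-homog else f = 0.

(* A sequence ... -> F_1 -> F_0 -> R of graded free modules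
   F_i = \bigoplus_(k < fr_rank i) R(- fr_shift i k), whose elements are row
   vectors; the maps are multiplication on the right by the matrices. *)
Record free_complex := FreeComplex {
  fr_rank : nat -> nat;
  fr_shift : forall i, 'I_(fr_rank i) -> int;
  fr_aug : 'cV[{mpoly K[n]}]_(fr_rank 0);
  fr_diff : forall i, 'M[{mpoly K[n]}]_(fr_rank i.+1, fr_rank i)
}.

Implicit Type F : free_complex.

(* All the maps are homogeneous of degree 0. *)
Definition graded_complex F : Prop :=
  (forall k, in_degree (fr_shift k) (fr_aug F k 0)) /\
  (forall i k l,
     in_degree (@fr_shift F i.+1 k - @fr_shift F i l) (fr_diff F i k l)).

Definition resolves F (I : {mpoly K[n]} -> Prop) : Prop :=
  [/\ forall f, I f <-> exists v : 'rV_(fr_rank F 0), f = (v *m fr_aug F) 0 0,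
      forall v : 'rV_(fr_rank F 0),
        v *m fr_aug F = 0 <-> exists w, v = w *m fr_diff F 0
    & forall i (v : 'rV_(fr_rank F i.+1)),
        v *m fr_diff F i = 0 <-> exists w, v = w *m fr_diff F i.+1].

(* The image of F_(i+1) lies in (x_1, ..., x_n) F_i. *)
Definition minimal_complex F : Prop :=
  forall i k l, (fr_diff F i k l)@_0%MM = 0.

Definition minimal_graded_free_resolution F I : Prop :=
  [/\ graded_complex F, resolves F I & minimal_complex F].

Definition betti F (i : nat) (j : int) : nat :=
  #|[set k : 'I_(fr_rank F i) | fr_shift k == j]|.

(* Minimal graded free resolutions are unique up to isomorphism, so the value r
   does not depend on the choice of F. *)
Definition regularity (I : {mpoly K[n]} -> Prop) (r : int) : Prop :=
  exists F, [/\ minimal_graded_free_resolution F I,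
    forall i j, betti F i j != 0%N -> j - i%:Z <= r
    & exists i j, betti F i j != 0%N /\ j - i%:Z = r].

Definition has_linear_resolution (I : {mpoly K[n]} -> Prop) : Prop :=
  [/\ graded_ideal I, nonzero_ideal I
    & exists2 a, initial_degree I a & regularity I a%:Z].

Definition componentwise_linear (I : {mpoly K[n]} -> Prop) : Prop :=
  graded_ideal I /\
  forall d, nonzero_ideal (degree_component_ideal I d) ->
    has_linear_resolution (degree_component_ideal I d).

End Resolutions.

Section MonomialIdeals.
Variables (K : fieldType) (n : nat).
Implicit Types (I : {mpoly K[n]} -> Prop) (S T : 'X_{1..n} -> Prop).

Definition monomial_gens S I : Prop :=
  forall f, I f <-> ideal_gen (fun g => exists2 u, S u & g = 'X_[u]) f.

Definition monomial_ideal I : Prop := exists S, monomial_gens S I.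

Definition minimal_monomial_gens S I : Prop :=
  monomial_gens S I /\
  forall T, (forall u, T u -> S u) -> monomial_gens T I ->
    forall u, S u -> T u.

(* The set G(I); a monomial ideal has exactly one minimal set of monomial
   generators. *)
Definition min_gens I : 'X_{1..n} -> Prop :=
  fun u => exists2 S, minimal_monomial_gens S I & S u.

Definition msupport (u : 'X_{1..n}) : {set 'I_n} := [set i | u i != 0%N].

Definition support_two_monomial_ideal I : Prop :=
  monomial_ideal I /\ forall u, min_gens I u -> #|msupport u| = 2%N.

Definition base_graph I : 'I_n -> 'I_n -> Prop :=
  fun i j => i <> j /\ exists2 u, min_gens I u & msupport u = [set i; j].

End MonomialIdeals.

Section Graphs.
Variable V : finType.
Implicit Type e : V -> V -> Prop.

Definition graph_compl e : V -> V -> Prop := fun x y => x <> y /\ ~ e x y.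

(* The adjacencies among the distinct vertices c_0, ..., c_(m-1) are exactly
   those of consecutive indices modulo m; [ordS] is the cyclic successor. *)
Definition induced_cycle e (m : nat) (c : 'I_m -> V) : Prop :=
  injective c /\ forall i j, e (c i) (c j) <-> j = ordS i \/ i = ordS j.

Definition chordal e : Prop :=
  forall m (c : 'I_m -> V), (3 < m)%N -> ~ induced_cycle e c.

End Graphs.

(* Main.v *)
(* Write H for the complement of the base graph.  The Koszul cohomology of R/I in
   the multidegrees a + t (t a set of variables in W) is the reduced cohomology of
   the complex of faces {t : x^(a + t) notin I}.  Its H^1 only sees the vertices,
   edges and triangles, and since all generators have support of size two, the
   edges and triangles only depend on the part of I in degrees <= |a| + 2; the
   linear resolution of I_<|a|+2> therefore kills H^1.  Gluing the unit steps
   a -> a + 1 coordinate by coordinate gives the same vanishing for the steps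
   0 -> N with N large, where the complex is the clique complex of H[W].  An edge of
   H[W] without a common neighbour of its ends in W is then a bridge of H[W]: this
   forbids induced cycles of length at least four, and it replaces the shortest path
   argument in Dirac's theorem on simplicial vertices.
   Finally sqrt(I) is the edge ideal I(G).  If v is simplicial in H and U is the set
   of its neighbours in G, then I(G) = I(G - v) + x_v (U) with I(G - v) contained in
   (U), and an iterated mapping cone produces a linear resolution. *)

Require Import Defs.
From HB Require Import structures.
From mathcomp Require Import all_boot all_order all_algebra.
From mathcomp Require Import mpoly.
From mathcomp Require Import ring zify.
From Stdlib Require Import ClassicalEpsilon FunctionalExtensionality PropExtensionality.

Set Implicit Arguments.
Unset Strict Implicit.
Unset Printing Implicit Defensive.

Import Order.TTheory GRing.Theory Num.Theory.
Local Open Scope ring_scope.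

(** * Coefficients, division by a variable, homogeneous parts *)

Section Coefficients.
Variables (K : fieldType) (n : nat).
Implicit Types (f g : {mpoly K[n]}) (m : 'X_{1..n}) (v : 'I_n).

Lemma sum_mcoeff f m :
  \sum_(k <- msupp f) f@_k * (k == m)%:R = f@_m.
Proof.
rewrite {3}(mpolyE f) raddf_sum /=.
by apply: eq_bigr => k _; rewrite mcoeffZ mcoeffX.
Qed.

Definition mpart (P : pred 'X_{1..n}) f : {mpoly K[n]} :=
  \sum_(k <- msupp f | P k) f@_k *: 'X_[k].

Lemma mcoeff_mpart P f m : (mpart P f)@_m = if P m then f@_m else 0.
Proof.
rewrite /mpart big_mkcond raddf_sum /= -(sum_mcoeff f m).
case Pm: (P m); [apply: eq_bigr | apply: big1] => k _.
  case: (k =P m) => [->|/eqP/negPf nkm]; first by rewrite Pm mcoeffZ mcoeffX eqxx.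
  by case: (P k); rewrite ?mcoeff0 ?mcoeffZ ?mcoeffX ?nkm mulr0.
case Pk: (P k); rewrite ?mcoeff0 // mcoeffZ mcoeffX.
by case: (k =P m) => [E|]; rewrite ?mulr0 //; rewrite E Pm in Pk.
Qed.

(** Division by x_v that drops the remainder; the guard matters because subtraction of exponents is
    truncated at 0. *)
Definition mquo v f : {mpoly K[n]} :=
  \sum_(k <- msupp f | k v != 0%N) f@_k *: 'X_[k - U_(v)].

Lemma mcoeff_mquo v f m : (mquo v f)@_m = f@_(m + U_(v)).
Proof.
rewrite /mquo big_mkcond raddf_sum /= -(sum_mcoeff f).
apply: eq_bigr => k _.
have [kv|kv] /= := eqVneq (k v) 0%N.
  rewrite mcoeff0; case: eqP => [E|]; rewrite ?mulr0 //.
  by move: kv; rewrite E mnmDE mnm1E eqxx addn1.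
rewrite mcoeffZ mcoeffX; congr (_ * (_)%:R).
have lek : (U_(v) <= k)%MM by rewrite lep1mP.
by rewrite -{2}(submK lek) eqm_add2r.
Qed.

Lemma mcoeffXM v f m : ('X_v * f)@_(m + U_(v)) = f@_m.
Proof. by rewrite mulrC addmC mcoeffMX. Qed.

Lemma mcoeffXM0 v f m : m v = 0%N -> ('X_v * f)@_m = 0.
Proof.
move=> mv; rewrite mulrC; apply: memN_msupp_eq0; apply/negP.
rewrite (perm_mem (msuppMX _ _)) => /mapP[k _ E].
by move: mv; rewrite E mnmDE mnm1E eqxx add1n.
Qed.

Lemma mcoeffXME v f m :
  ('X_v * f)@_m = if m v == 0%N then 0 else f@_(m - U_(v)).
Proof.
case: eqP => [/mcoeffXM0->//|/eqP mv].
have lem : (U_(v) <= m)%MM by rewrite lep1mP.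
by rewrite -{1}(submK lem) mcoeffXM.
Qed.

Lemma mquoX v f : mquo v ('X_v * f) = f.
Proof. by apply/mpolyP => m; rewrite mcoeff_mquo mcoeffXM. Qed.

Lemma mquoXC u v f : u != v -> mquo v ('X_u * f) = 'X_u * mquo v f.
Proof.
move=> uv; apply/mpolyP => m; rewrite mcoeff_mquo !mcoeffXME.
rewrite mnmDE mnm1E [v == u]eq_sym (negPf uv) addn0; case: eqP => // /eqP mu.
rewrite mcoeff_mquo; congr (_@_ _); apply/mnmP => i.
rewrite !(mnmDE, mnmBE, mnm1E).
case: (u =P i) => [<-|] /=; last by rewrite !subn0.
by case: (v =P u) => [E|]; [rewrite E eqxx in uv|rewrite !addn0].
Qed.

Lemma mquo_is_additive v : {morph mquo v : f g / f - g}.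
Proof.
by move=> f g; apply/mpolyP => m; rewrite mcoeffB !mcoeff_mquo mcoeffB.
Qed.
HB.instance Definition _ v :=
  GRing.isZmodMorphism.Build {mpoly K[n]} {mpoly K[n]} (mquo v) (mquo_is_additive v).

Lemma mpart_mquo v f : f = mpart (fun m => m v == 0%N) f + 'X_v * mquo v f.
Proof.
apply/mpolyP => m; rewrite mcoeffD mcoeff_mpart mcoeffXME.
case: eqP => [|/eqP mv]; first by rewrite addr0.
by rewrite add0r mcoeff_mquo submK // lep1mP.
Qed.

Lemma dhomog_coeffP f d :
  f \is d.-homog <-> (forall m, f@_m != 0 -> mdeg m = d).
Proof.
split=> [/dhomogP H m mf|H].
  by apply: H; rewrite mcoeff_msupp.
by apply/dhomogP => m; rewrite mcoeff_msupp => /H.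
Qed.

Lemma pihomog_mpart d f : pihomog mdeg d f = mpart (fun m => mdeg m == d) f.
Proof. by rewrite pihomogE. Qed.

End Coefficients.

(** * Koszul cochains and their differential *)

Section KoszulDifferential.
Variable n : nat.
Implicit Types (s t : {set 'I_n}) (u v : 'I_n).

Definition nbelow v t : nat := #|[set u in t | (u < v)%N]|.

Lemma nbelowD1 u v t : u \in t ->
  nbelow v t = ((u < v)%N + nbelow v (t :\ u))%N.
Proof.
move=> ut; rewrite /nbelow (cardsD1 u) !inE ut /=; congr (_ + _)%N.
by apply: eq_card => i; rewrite !inE andbA.
Qed.

Lemma nbelowU1 u v t : u \notin t ->
  nbelow v (u |: t) = ((u < v)%N + nbelow v t)%N.
Proof. by move=> ut; rewrite (@nbelowD1 u) ?setU11 // setU1K. Qed.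

Variables (A : comNzRingType) (x : 'I_n -> A).

Section Def.
Variable V : lmodType A.
Implicit Types f g : {set 'I_n} -> V.

(** With [x v] the variable x_v this is the Koszul differential; with [x v] in {0, 1} it is a
    simplicial coboundary. *)
Definition kd f t : V :=
  \sum_(v in t) ((-1) ^+ nbelow v t * x v) *: f (t :\ v).

Lemma eq_kd f g t : (forall v, v \in t -> f (t :\ v) = g (t :\ v)) ->
  kd f t = kd g t.
Proof. by move=> E; apply: eq_bigr => v /E ->. Qed.

Lemma kd0 f t : (forall v, v \in t -> f (t :\ v) = 0) -> kd f t = 0.
Proof. by move=> E; apply: big1 => v /E ->; rewrite scaler0. Qed.

Lemma kdD f g t : kd (fun s => f s + g s) t = kd f t + kd g t.
Proof. by rewrite -big_split; apply: eq_bigr => v _; rewrite scalerDr. Qed.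

Lemma kdB f g t : kd (fun s => f s - g s) t = kd f t - kd g t.
Proof. by rewrite -sumrB; apply: eq_bigr => v _; rewrite scalerBr. Qed.

(** Removing [u] and [v] in the two orders gives opposite signs: the smaller counts in the [nbelow]
    of the larger only while it is still present. *)
Lemma kd_kd f t : kd (kd f) t = 0.
Proof.
pose T v u := ((-1) ^+ (nbelow v t + nbelow u (t :\ v)) * (x v * x u))
                *: f (t :\ v :\ u).
pose S v u := if (v \in t) && (u \in t) then T v u else 0.
have SS v u : (u < v)%N -> S v u + S u v = 0.
  move=> uv; rewrite /S [(u \in t) && _]andbC.
  case: ifP => [/andP[vt ut]|_]; last by rewrite addr0.
  have -> : T u v = ((-1) ^+ (nbelow u t + nbelow v (t :\ u)) * (x u * x v))
                *: f (t :\ v :\ u) by rewrite /T !setDDl [[set u] :|: _]setUC.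
  rewrite /T -scalerDl [X in X *: _](_ : _ = 0) ?scale0r //.
  rewrite (@nbelowD1 u v t) // (@nbelowD1 v u t) // uv ltnNge (ltnW uv) /=.
  by rewrite add0n !exprD !expr1; ring.
have E v : v \in t ->
    ((-1) ^+ nbelow v t * x v) *: kd f (t :\ v)
    = \sum_(u < n | (u < v)%N) S v u + \sum_(u < n | (v < u)%N) S v u.
  move=> vt; rewrite scaler_sumr.
  transitivity (\sum_(u in t :\ v) T v u).
    apply: eq_bigr => u _; rewrite scalerA /T; congr (_ *: _).
    by rewrite exprD; ring.
  rewrite (bigID (fun u : 'I_n => (u < v)%N)) /=; congr (_ + _).
    rewrite [RHS]big_mkcond [LHS]big_mkcond; apply: eq_bigr => u _.
    rewrite !inE /S vt /=; case: ltngtP => uv; rewrite ?andbF //.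
    have -> : u != v by apply: contraTneq uv => ->; rewrite ltnn.
    by case: (u \in t).
  rewrite [RHS]big_mkcond [LHS]big_mkcond; apply: eq_bigr => u _.
  rewrite !inE /S vt /=; case: ltngtP => uv; rewrite ?andbF //.
    have -> : u != v by apply: contraTneq uv => ->; rewrite ltnn.
    by case: (u \in t).
  by move/val_inj: uv => ->; rewrite eqxx.
have -> : kd (kd f) t = \sum_(v < n) (\sum_(u < n | (u < v)%N) S v u
                              + \sum_(u < n | (v < u)%N) S v u).
  rewrite /kd big_mkcond; apply: eq_bigr => v _; case: ifP => [/E//|vt].
  by rewrite !big1 ?addr0 // => u _; rewrite /S vt.
rewrite big_split /=.
rewrite [X in _ + X](exchange_big_dep xpredT) //= -big_split.
by apply: big1 => v _; rewrite -big_split; apply: big1 => u; apply: SS.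
Qed.

End Def.

End KoszulDifferential.

(** * Exactness of the Koszul complex *)

Section KoszulExact.
Variables (K : fieldType) (n : nat).
Local Notation R := {mpoly K[n]}.
Local Notation X := (fun v : 'I_n => 'X_v : R).
Implicit Types (f g : {set 'I_n} -> R^o) (s t : {set 'I_n}).

Definition khom v f t : R^o :=
  if v \in t then 0 else (-1) ^+ nbelow v t * mquo v (f (v |: t)).

Definition krest v f t : R^o :=
  if v \in t then mpart (fun m => m v == 0%N) (f t) else 0.

(** A homotopy from the identity to [krest v]. For [v] in [t] only the [v]-summand survives and
    misses the terms free of x_v; for [v] outside [t] division undoes x_v exactly and the other
    summands cancel by sign. *)
Lemma khomP v f t : kd X (khom v f) t + khom v (kd X f) t = f t - krest v f t.
Proof.
rewrite /krest {2}/khom; case: ifP => vt.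
  rewrite addr0 /kd (bigD1 v) //= big1 ?addr0 => [|u /andP[ut uv]]; last first.
    by rewrite /khom !inE eq_sym uv vt scaler0.
  rewrite /khom !inE eqxx /= setD1K // (@nbelowD1 _ v v t) // ltnn add0n.
  rewrite -[_ *: _]/(_ * _) mulrACA -expr2 sqrr_sign mul1r.
  by apply/eqP; rewrite eq_sym subr_eq addrC -mpart_mquo.
rewrite subr0 [in X in _ + X]/kd (bigD1 v) ?setU11 //= setU1K ?vt //.
rewrite (@nbelowU1 _ v v) ?vt // ltnn add0n raddfD mulrDr /= addrCA.
have -> : (-1) ^+ nbelow v t * mquo v (((-1) ^+ nbelow v t * 'X_v) *: f t) = f t.
  rewrite -[_ *: _]/(_ * _) -mulrA raddfMsign /= mquoX mulrA -expr2 sqrr_sign.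
  by rewrite mul1r.
rewrite [X in _ + X](_ : _ = 0) ?addr0 // raddf_sum mulr_sumr /=.
rewrite [X in _ + X](_ : _ = \sum_(u in t) (-1) ^+ nbelow v t *
   mquo v (((-1) ^+ nbelow u (v |: t) * 'X_u) *: f ((v |: t) :\ u))); last first.
  apply: eq_bigl => u; rewrite !inE andbC.
  by case: eqP => [->|_]; rewrite ?vt // andbT.
rewrite -big_split; apply: big1 => u ut /=.
have uv : u != v by apply: contraTneq ut => ->; rewrite vt.
rewrite /khom !inE [v == u]eq_sym (negPf uv) vt /=.
rewrite -![_ *: _]/(_ * _) -[_ * _ * f _]mulrA raddfMsign /= mquoXC //.
rewrite (@nbelowD1 _ u v t) // (@nbelowU1 _ v u) ?vt //.
have -> : v |: (t :\ u) = (v |: t) :\ u.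
  apply/setP => i; rewrite !inE.
  by case: (i =P v) => [->|//]; rewrite eq_sym uv.
have uv' : (u != v :> nat) by [].
by rewrite !exprD; case: ltngtP uv' => // _ _; rewrite /= ?expr1 ?expr0; ring.
Qed.

(* The variables are contracted one at a time; only the constant term in top
   cochain degree survives. *)
Lemma koszul_exact f : (forall t, kd X f t = 0) -> (f setT : R)@_0 = 0 ->
  exists g : {set 'I_n} -> R^o, forall t, f t = kd X g t.
Proof.
move=> fZ fT.
(* Invariant after contracting a list of variables: the remainder [h] lives on sets containing all
   of them and involves none of them. *)
have [g [h [Dfg hZ hT ht hm]]] : exists g h : {set 'I_n} -> R^o,
   [/\ forall t, f t = kd X g t + h t, forall t, kd X h t = 0,
       (h setT : R)@_0 = 0,
       forall t v, v \in enum 'I_n -> v \notin t -> h t = 0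
     & forall t v (m : 'X_{1..n}), v \in enum 'I_n -> m v != 0%N ->
         (h t : R)@_m = 0].
  elim: (enum 'I_n) => [|v r [g [h [Dfg hZ hT ht hm]]]].
    exists (fun _ => 0), f; split => // t.
    by rewrite kd0 ?add0r.
  have hE t : krest v h t = h t - kd X (khom v h) t.
    have := khomP v h t; rewrite [X in _ + X](_ : _ = 0) ?addr0 => [->|].
      by rewrite opprB addrC subrK.
    by rewrite /khom hZ raddf0 mulr0; case: ifP.
  exists (fun t => g t + khom v h t), (krest v h); split => [t|t|||].
  - by rewrite kdD hE Dfg -addrA [_ + (h t - _)]addrC subrK.
  - rewrite (@eq_kd _ _ _ _ _ (fun s => h s - kd X (khom v h) s)) => [|u _].
      by rewrite kdB hZ kd_kd subrr.
    exact: hE.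
  - by rewrite /krest inE mcoeff_mpart hT if_same.
  - move=> t u; rewrite inE /krest => /predU1P[->|ur] ut.
      by rewrite (negPf ut).
    rewrite (ht t u) //; case: ifP => // _; apply/mpolyP => m.
    by rewrite mcoeff_mpart mcoeff0 if_same.
  - move=> t u m; rewrite inE /krest => /predU1P[->|ur] mu.
      by case: ifP => _; rewrite ?mcoeff0 // mcoeff_mpart (negPf mu).
    by case: ifP => _; rewrite ?mcoeff0 // mcoeff_mpart (hm t u) ?if_same.
exists g => t; rewrite Dfg [h t](_ : _ = 0) ?addr0 //.
have [/eqP->|] := boolP (t == setT); last first.
  rewrite -subTset => /subsetPn[v _ vt].
  by rewrite (ht t v) ?mem_enum.
apply/mpolyP => m; rewrite mcoeff0.
have [->//|/eqP m0] := eqVneq m 0%MM.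
have [v mv] : exists v, m v != 0%N.
  case: (pickP (fun v => m v != 0%N)) => [v|H]; first by exists v.
  by case: m0; apply/mnmP => i; rewrite mnm0E; apply/eqP/negbFE/H.
by rewrite (hm _ v) ?mem_enum.
Qed.

Lemma koszul_exact_row r (f : {set 'I_n} -> 'rV[R]_r) :
  (forall t, kd X f t = 0) -> (forall k, (f setT 0 k)@_0 = 0) ->
  exists g : {set 'I_n} -> 'rV[R]_r, forall t, f t = kd X g t.
Proof.
move=> fZ fT.
have E (g : {set 'I_n} -> 'rV[R]_r) t k :
    kd X g t 0 k = kd X (fun s => g s 0 k : R^o) t.
  by rewrite /kd summxE; apply: eq_bigr => v _; rewrite mxE.
have /fin_all_exists[g Dg] (k : 'I_r) : exists g : {set 'I_n} -> R^o,
    forall t, f t 0 k = kd X g t.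
  by apply: koszul_exact => [t|//]; rewrite -E fZ mxE.
exists (fun t => \row_k g k t) => t; apply/rowP => k; rewrite E Dg.
by rewrite /kd; apply: eq_bigr => v _; rewrite mxE.
Qed.

End KoszulExact.

(** * Integer degrees and homogeneous lifting *)

Section IntegerDegrees.
Variables (K : fieldType) (n : nat).
Implicit Types (f g : {mpoly K[n]}) (a b : int).

Lemma in_degreeP a f :
  in_degree a f <-> (forall m, f@_m != 0 -> (mdeg m)%:Z = a).
Proof.
case: a => e /=; first by rewrite dhomog_coeffP; split=> H m /H; [move->|case].
split=> [-> m|H]; first by rewrite mcoeff0 eqxx.
by apply/mpolyP => m; rewrite mcoeff0; apply/eqP/negPn/negP => /H.
Qed.

Lemma in_degree0 a : in_degree a (0 : {mpoly K[n]}).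
Proof. by apply/in_degreeP => m; rewrite mcoeff0 eqxx. Qed.

Lemma in_degreeD a f g : in_degree a f -> in_degree a g -> in_degree a (f + g).
Proof.
case: a => e /=; first exact: dhomogD.
by move=> -> ->; rewrite addr0.
Qed.

Lemma in_degree_sum (I : finType) (P : pred I) a (F : I -> {mpoly K[n]}) :
  (forall i, P i -> in_degree a (F i)) -> in_degree a (\sum_(i | P i) F i).
Proof.
move=> H; apply: (big_ind (in_degree a)) => //; first exact: in_degree0.
exact: in_degreeD.
Qed.

Lemma in_degreeM a b f g :
  in_degree a f -> in_degree b g -> in_degree (a + b) (f * g).
Proof.
move=> /in_degreeP fa /in_degreeP gb; apply/in_degreeP => m.
rewrite -mcoeff_msupp => /msuppM_le/allpairsP[[m1 m2] /= [m1f m2g ->]].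
by rewrite mdegD PoszD fa -?mcoeff_msupp // gb -?mcoeff_msupp.
Qed.

Lemma in_degree_sign a k f : in_degree a f -> in_degree a ((-1) ^+ k * f).
Proof.
rewrite -signr_odd mulr_sign => fa; case: (odd k) => //.
by case: a fa => e /= => [|->]; rewrite ?dhomogN ?oppr0.
Qed.

Definition zpart a f := mpart (fun m => (mdeg m)%:Z == a) f.

Lemma zpart_in_degree a f : in_degree a (zpart a f).
Proof.
by apply/in_degreeP => m; rewrite mcoeff_mpart; case: ifP => [/eqP//|_]; rewrite eqxx.
Qed.

Lemma zpart_id a f : in_degree a f -> zpart a f = f.
Proof.
move/in_degreeP => fa; apply/mpolyP => m; rewrite mcoeff_mpart.
by case: ifP => // /eqP E; apply/esym/eqP/negPn/negP => /fa.
Qed.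

Lemma zpartD a f g : zpart a (f + g) = zpart a f + zpart a g.
Proof.
by apply/mpolyP => m; rewrite /zpart mcoeffD !mcoeff_mpart mcoeffD;
case: ifP; rewrite ?addr0.
Qed.

Lemma zpart_sum a (I : finType) (F : I -> {mpoly K[n]}) :
  zpart a (\sum_i F i) = \sum_i zpart a (F i).
Proof.
apply: (big_morph (zpart a)); first exact: zpartD.
by apply: zpart_id; apply: (in_degree0 a).
Qed.

Lemma zpartM a b f g : in_degree b g -> zpart (a + b) (f * g) = zpart a f * g.
Proof.
move=> gb; rewrite -[f in LHS](subrK (zpart a f)) mulrDl zpartD.
rewrite [X in _ + X]zpart_id; last exact/in_degreeM/gb/zpart_in_degree.
rewrite [X in X + _](_ : _ = 0) ?add0r //; apply/mpolyP => m.
rewrite mcoeff_mpart mcoeff0; case: ifP => // /eqP E; apply/eqP.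
rewrite mcoeff_eq0; apply/negP => /msuppM_le/allpairsP[[m1 m2] /= [m1f m2g Em]].
move: m1f; rewrite mcoeff_msupp mcoeffB mcoeff_mpart.
case: ifP; rewrite ?subrr ?eqxx // => /eqP.
have /in_degreeP/(_ m2) := gb; rewrite -mcoeff_msupp => /(_ m2g) Eb.
by move: E; rewrite Em mdegD PoszD Eb => /addIr.
Qed.

(** Replacing each entry of [w] by its component in the degree prescribed by the shifts does not
    change the product, since both [M] and the product are homogeneous. *)
Lemma homogeneous_lift p q (M : 'M[{mpoly K[n]}]_(p, q)) (s : 'I_p -> int)
    (t : 'I_q -> int) a (w : 'rV_p) :
  (forall k l, in_degree (s k - t l) (M k l)) ->
  (forall l, in_degree (a - t l) ((w *m M) 0 l)) ->
  exists2 w' : 'rV_p, w' *m M = w *m M & forall k, in_degree (a - s k) (w' 0 k).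
Proof.
move=> Mh wh; exists (\row_k zpart (a - s k) (w 0 k)) => [|k]; last first.
  by rewrite mxE; apply: zpart_in_degree.
apply/rowP => l; rewrite -[RHS](zpart_id (wh l)) !mxE zpart_sum.
apply: eq_bigr => k _; rewrite mxE -(zpartM _ _ (Mh k l)).
by congr (zpart _ _); ring.
Qed.

End IntegerDegrees.

(** * Vanishing of Koszul cohomology above the regularity *)

Section LinearResolutionChase.
Variables (K : fieldType) (n : nat) (J : {mpoly K[n]} -> Prop).
Local Notation R := {mpoly K[n]}.
Local Notation X := (fun v : 'I_n => 'X_v : R).
Variables (F : free_complex K n) (d : int).
Hypothesis FJ : minimal_graded_free_resolution F J.
Hypothesis shift_le : forall i (k : 'I_(fr_rank F i)), fr_shift k - i%:Z <= d.

Lemma kd_mulmxr p q (M : 'M[R]_(p, q)) (Z : {set 'I_n} -> 'rV[R]_p) t :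
  kd X (fun s => Z s *m M) t = kd X Z t *m M.
Proof. by rewrite mulmx_suml; apply: eq_bigr => v _; rewrite scalemxAl. Qed.

Lemma in_degree_kd (a : int) (f : {set 'I_n} -> R^o) (t : {set 'I_n}) :
  (forall s : {set 'I_n}, in_degree (a + #|s|%:Z) (f s : R)) ->
  in_degree (a + #|t|%:Z) (kd X f t : R).
Proof.
move=> fh; apply: in_degree_sum => v vt; rewrite -[_ *: _]/(_ * _) -mulrA.
apply: in_degree_sign.
rewrite (_ : a + _ = 1 + (a + #|t :\ v|%:Z)); last first.
  by rewrite [#|t|](cardsD1 v) vt; lia.
by apply: in_degreeM => //=; rewrite dhomogX /= mdeg1.
Qed.

Lemma kd_row r (f : {set 'I_n} -> 'rV[R]_r) t k :
  kd X f t 0 k = kd X (fun s => f s 0 k : R^o) t.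
Proof. by rewrite /kd summxE; apply: eq_bigr => v _; rewrite mxE. Qed.

(* A chase through the double complex of Koszul cochains in F.  It ends in cochain
   degree n, where the bound on the shifts forces all entries to have positive
   degree, hence to be Koszul coboundaries. *)
Lemma resolution_chase q j p (D : int) (Z : {set 'I_n} -> 'rV[R]_(fr_rank F j)) :
  n = (p + q)%N -> (forall t : {set 'I_n}, #|t| <> p -> Z t = 0) ->
  (forall (t : {set 'I_n}) k, in_degree (D + #|t|%:Z - fr_shift k) (Z t 0 k)) ->
  d + j%:Z < D + p%:Z ->
  (forall t, exists w, kd X Z t = w *m fr_diff F j) ->
  exists Y : {set 'I_n} -> 'rV[R]_(fr_rank F j),
    forall t, exists w, Z t - kd X Y t = w *m fr_diff F j.
Proof.
case: FJ => [[_ Fh] [_ ex0 exS] Fmin].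
have diff_diff i (w : 'rV_(fr_rank F i.+2)) : w *m fr_diff F i.+1 *m fr_diff F i = 0.
  by apply: (exS _ _).2; exists w.
elim: q j p Z => [|q IHq] j p Z En Zp Zh lt_d Zim.
  have kZ t : kd X Z t = 0.
    apply: kd0 => v vt; apply: Zp => E; have := subset_leq_card (subsetT t).
    by rewrite cardsT card_ord (cardsD1 v) vt E; lia.
  have [|Y DY] := koszul_exact_row kZ; last first.
    by exists Y => t; exists 0; rewrite DY subrr mul0mx.
  (* In cochain degree n the entry has degree [D + n - fr_shift k], which is positive by the bound
     on the shifts. *)
  move=> k; have /in_degreeP := Zh setT k; rewrite cardsT card_ord => H.
  apply/eqP/negPn/negP => /H; rewrite mdeg0 => E.
  by have := shift_le k; lia.
(* The lift is taken homogeneous and concentrated in cochain degree [p.+1], so that the induction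
   hypothesis applies one step further in [F]. *)
have lift (t : {set 'I_n}) : exists w,
    [/\ kd X Z t = w *m fr_diff F j, (#|t| <> p.+1 -> w = 0)
    & forall k, in_degree (D + #|t|%:Z - fr_shift k) (w 0 k)].
  have [tp|tp] := eqVneq #|t| p.+1; last first.
    exists 0; split => // [|k]; last by rewrite mxE; apply: in_degree0.
    rewrite mul0mx; apply: kd0 => v vt; apply: Zp => tvp.
    by move: tp; rewrite (cardsD1 v) vt tvp add1n eqxx.
  have [w Dw] := Zim t.
  have [|w' Dw' w'h] := @homogeneous_lift _ _ _ _ (fr_diff F j) (@fr_shift _ _ F j.+1)
     (@fr_shift _ _ F j) (D + #|t|%:Z) w (Fh j).
    move=> l; rewrite -Dw kd_row (addrAC D).
    by apply: in_degree_kd => s; rewrite (addrAC D).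
  by exists w'; split => //; rewrite Dw'.
have /fin_all_exists[Z' /all_and3[DZ' Z'p Z'h]] := lift.
have kZ'im t : exists w, kd X Z' t = w *m fr_diff F j.+1.
  apply: (exS _ _).1; rewrite -kd_mulmxr.
  by rewrite (@eq_kd _ _ _ _ _ (kd X Z)) ?kd_kd.
have [||||//|Y' DY'] := IHq j.+1 p.+1 Z'.
- by rewrite addSnnS.
- by move=> t; apply: Z'p.
- exact: Z'h.
- by lia.
(* The correction by [Y'] gives a cocycle because [Z' - kd X Y'] lies in the image of the next
   differential. *)
have kf t : kd X (fun s => Z s - Y' s *m fr_diff F j) t = 0.
  rewrite kdB kd_mulmxr DZ' -mulmxBl; have [w ->] := DY' t; exact: diff_diff.
have [k|Y DY] := koszul_exact_row kf; last first.
  exists Y => t; exists (Y' t); rewrite -DY; exact: subKr.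
(* Here [p] is less than n, so [Z] vanishes on [setT]; minimality of [F] kills the constant terms of
   the correction. *)
rewrite Zp ?sub0r; last by rewrite cardsT card_ord; lia.
rewrite !mxE mcoeffN raddf_sum big1 ?oppr0 // => l _.
by rewrite /= rmorphM /= Fmin mulr0.
Qed.

(** Cochain degree [p] of the Koszul cohomology of R/J: the coboundary has degree above [d], and
    lifting it to the first free module gives a cochain to which [resolution_chase] applies. *)
Lemma linear_resolution_chase p (P : {set 'I_n} -> R^o) (e : int) :
  (forall t : {set 'I_n}, #|t| <> p -> P t = 0) ->
  (forall t : {set 'I_n}, in_degree (e + #|t|%:Z) (P t : R)) ->
  d < e + p.+1%:Z -> (p < n)%N ->
  (forall f, J f -> f@_0 = 0) ->
  (forall t, J (kd X P t)) ->
  exists Q : {set 'I_n} -> R^o, forall t, J (P t - kd X Q t).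
Proof.
move=> Pp Ph lt_d lt_pn J0 PJ; case: (FJ) => [[Fa _] [Jim ex0 _] _].
have lift (t : {set 'I_n}) : exists w : 'rV_(fr_rank F 0),
    [/\ kd X P t = (w *m fr_aug F) 0 0, (#|t| <> p.+1 -> w = 0)
    & forall k, in_degree (e + #|t|%:Z - fr_shift k) (w 0 k)].
  have [tp|tp] := eqVneq #|t| p.+1; last first.
    exists 0; split => // [|k]; last by rewrite mxE; apply: in_degree0.
    rewrite mul0mx mxE; apply: kd0 => v vt; apply: Pp => tvp.
    by move: tp; rewrite (cardsD1 v) vt tvp add1n eqxx.
  have /Jim[w Dw] := PJ t.
  have [||w' Dw' w'h] := @homogeneous_lift _ _ _ _ (fr_aug F) (@fr_shift _ _ F 0)
     (fun _ => 0) (e + #|t|%:Z) w.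
  - by move=> k l; rewrite subr0 ord1; apply: Fa.
  - by move=> l; rewrite ord1 -Dw subr0; apply: in_degree_kd.
  by exists w'; split => //; rewrite Dw'.
have /fin_all_exists[Z /all_and3[DZ Zp Zh]] := lift.
have kdaug (f : {set 'I_n} -> 'rV_(fr_rank F 0)) t :
    (kd X f t *m fr_aug F) 0 0 = kd X (fun s => (f s *m fr_aug F) 0 0 : R^o) t.
  by rewrite -kd_mulmxr kd_row.
have kZim t : exists w, kd X Z t = w *m fr_diff F 0.
  apply: (ex0 _).1; apply/rowP => k; rewrite ord1 kdaug mxE.
  by rewrite (@eq_kd _ _ _ _ _ (kd X P)) ?kd_kd.
have [||Y DY] := @resolution_chase (n - p.+1) 0 p.+1 e Z _ Zp Zh _ kZim.
- by rewrite subnKC.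
- by rewrite addr0.
have kf t : kd X (fun s => P s - (Y s *m fr_aug F) 0 0 : R^o) t = 0.
  rewrite kdB -kdaug DZ; have /ex0 : exists w, Z t - kd X Y t = w *m fr_diff F 0 by [].
  by rewrite mulmxBl => /rowP/(_ 0); rewrite !mxE.
have [|Q DQ] := koszul_exact kf; last first.
  exists Q => t; rewrite -DQ opprB addrC subrK; apply/Jim; by exists (Y t).
rewrite Pp ?sub0r; last by rewrite cardsT card_ord; lia.
by rewrite mcoeffN J0 ?oppr0 //; apply/Jim; exists (Y setT).
Qed.

End LinearResolutionChase.

(** * Monomial ideals and their minimal generators *)

Section MonomialIdealFacts.
Variables (K : fieldType) (n : nat).
Local Notation R := {mpoly K[n]}.
Implicit Types (f g : R) (m u : 'X_{1..n}) (I : R -> Prop).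

Lemma ideal_gen_ideal (S : R -> Prop) : is_ideal (ideal_gen S).
Proof.
split=> [|f g [s sS ->] [t tS ->]|f g [s sS ->]].
- by exists [::]; rewrite ?big_nil.
- exists (s ++ t); last by rewrite big_cat.
  by move=> p; rewrite mem_cat => /orP[/sS|/tS].
- exists [seq (f * p.1, p.2) | p <- s]; first by move=> p /mapP[q /sS Sq ->].
  by rewrite big_map mulr_sumr; apply: eq_bigr => p _; rewrite mulrA.
Qed.

Lemma ideal_gen_mem (S : R -> Prop) f : S f -> ideal_gen S f.
Proof.
move=> Sf; exists [:: (1, f)]; last by rewrite big_seq1 mul1r.
by move=> p; rewrite inE => /eqP->.
Qed.

Lemma ideal_gen_sub (S : R -> Prop) I f :
  is_ideal I -> (forall g, S g -> I g) -> ideal_gen S f -> I f.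
Proof.
move=> [I0 ID IM] SI [s sS ->]; rewrite big_seq.
by apply: big_ind => // p /sS/SI; apply: IM.
Qed.

Lemma ideal_sum I (T : eqType) (s : seq T) (F : T -> R) :
  is_ideal I -> (forall p, p \in s -> I (F p)) -> I (\sum_(p <- s) F p).
Proof. by move=> [I0 ID _] IF; rewrite big_seq; apply: big_ind. Qed.

Lemma idealZ I (c : K) f : is_ideal I -> I f -> I (c *: f).
Proof. by move=> [_ _ IM] If; rewrite -mul_mpolyC; apply: IM. Qed.

Lemma ideal_monomial_le I u m :
  is_ideal I -> I 'X_[u] -> (u <= m)%MM -> I 'X_[m].
Proof. by move=> [_ _ IM] Iu /submK <-; rewrite mpolyXD; apply: IM. Qed.

Lemma monomial_ideal_genP (S : 'X_{1..n} -> Prop) f :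
  ideal_gen (fun g => exists2 u, S u & g = 'X_[u]) f <->
  (forall m, f@_m != 0 -> exists2 u, S u & (u <= m)%MM).
Proof.
split=> [[s sS ->] m|H].
  rewrite raddf_sum /=; elim: s sS => [|p s IHs] sS; first by rewrite big_nil eqxx.
  rewrite big_cons; have [pm|pm _] := eqVneq (p.1 * p.2)@_m 0.
    by rewrite pm add0r; apply: IHs => q qs; apply: sS; rewrite inE qs orbT.
  have [|u Su Dp] := sS p; first by rewrite inE eqxx.
  exists u => //; move: pm; rewrite Dp -mcoeff_msupp (perm_mem (msuppMX _ _)).
  by move=> /mapP[k _ ->]; apply: lem_addr.
rewrite (mpolyE f); apply: ideal_sum; first exact: ideal_gen_ideal.
move=> m; rewrite mcoeff_msupp => /H[u Su le_um].
apply: idealZ; first exact: ideal_gen_ideal.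
apply: (ideal_monomial_le (ideal_gen_ideal _) _ le_um).
by apply: ideal_gen_mem; exists u.
Qed.

Variable I : R -> Prop.
Hypothesis Imon : monomial_ideal I.

Lemma monomial_ideal_is_ideal : is_ideal I.
Proof.
have [S SI] := Imon; have [J0 JD JM] := ideal_gen_ideal
  (fun g => exists2 u, S u & g = 'X_[u] :> R).
split=> [|f g /SI If /SI Ig|f g /SI Ig]; apply/SI => //; last exact: JM.
exact: JD.
Qed.

Lemma monomial_idealP f : I f <-> (forall m, f@_m != 0 -> I 'X_[m]).
Proof.
have [S SI] := Imon; split=> [/SI/monomial_ideal_genP If m /If[u Su um]|H].
  apply/SI/monomial_ideal_genP => m'; rewrite mcoeffX; have [<- _|_] := eqVneq m m'.
    by exists u.
  by rewrite eqxx.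
rewrite (mpolyE f); apply: ideal_sum; first exact: monomial_ideal_is_ideal.
move=> m; rewrite mcoeff_msupp => /H.
by apply: idealZ; apply: monomial_ideal_is_ideal.
Qed.

Lemma min_gens_mem u : min_gens I u -> I 'X_[u].
Proof.
move=> [S [SI _] Su]; apply/SI/ideal_gen_mem; by exists u.
Qed.

Definition minimal_exponent u :=
  I 'X_[u] /\ (forall u', I 'X_[u'] -> (u' <= u)%MM -> u' = u).

Lemma minimal_exponent_le m :
  I 'X_[m] -> exists2 u, minimal_exponent u & (u <= m)%MM.
Proof.
have [k] := ubnP (mdeg m); elim: k m => // k IHk m lt_mk Im.
have [[u [Iu le_u ne_u]]|H] :=
    classic (exists u, [/\ I 'X_[u], (u <= m)%MM & u <> m]).
  have [|w Hw le_w] := IHk u _ Iu; last by exists w => //; apply: lepm_trans le_u.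
  move: lt_mk; rewrite ltnS; apply: leq_trans.
  rewrite -(submK le_u) mdegD -[X in (X < _)%N]add0n ltn_add2r.
  rewrite lt0n mdeg_eq0; apply: contra_notN ne_u => /eqP E.
  by rewrite -(submK le_u) E add0m.
exists m; last exact: lepm_refl; split=> // u Iu le_u.
by apply: NNPP => ne; apply: H; exists u.
Qed.

(** Any set of generators contains a divisor of a divisibility-minimal exponent, and this divisor is
    the exponent itself; hence these exponents form a minimal generating set. *)
Lemma min_gens_minimal u : minimal_exponent u -> min_gens I u.
Proof.
move=> umin; exists minimal_exponent => //.
split=> [f|T TS TI w [Iw wmin]].
  rewrite monomial_ideal_genP monomial_idealP.
  split=> H m /H; first exact: minimal_exponent_le.
  by move=> [w [Iw _]]; apply: ideal_monomial_le monomial_ideal_is_ideal _.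
have /TI/monomial_ideal_genP/(_ w) := Iw; rewrite mcoeffX eqxx oner_eq0.
by move=> /(_ isT)[t Tt le_t]; rewrite -(wmin t) //; have [] := TS t Tt.
Qed.

Lemma min_gens_le m : I 'X_[m] -> exists2 u, min_gens I u & (u <= m)%MM.
Proof.
move=> /minimal_exponent_le[u umin le_u].
by exists u => //; apply: min_gens_minimal.
Qed.

End MonomialIdealFacts.

(** * First cohomology of the complexes between two exponents *)

Section IntervalComplexes.
Variables (K : fieldType) (n : nat) (I : {mpoly K[n]} -> Prop).
Hypothesis I2 : support_two_monomial_ideal I.
Hypothesis Icl : componentwise_linear I.
Local Notation R := {mpoly K[n]}.
Local Notation X := (fun v : 'I_n => 'X_v : R).
Implicit Types (m u : 'X_{1..n}) (s t : {set 'I_n}) (a b : 'I_n -> nat).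

Let Imon : monomial_ideal I := proj1 I2.
Let Iid : is_ideal I := monomial_ideal_is_ideal Imon.

Lemma support_two_le m : I 'X_[m] ->
  exists u, [/\ min_gens I u, (u <= m)%MM & #|msupport u| = 2%N].
Proof.
by move=> /(min_gens_le Imon)[u umin le_u]; exists u; split=> //; apply: I2.2.
Qed.

Variable W : {set 'I_n}.
Hypothesis W3 : (2 < #|W|)%N.
Local Notation B := (~: W).

(* Subsets of W are encoded as the sets t containing B, so that the signs of the
   Koszul complex on all n variables can be kept. *)
Definition interval_exponent a b t : 'X_{1..n} :=
  [multinom if v \in W then (if v \in t then b v else a v) else 0%N | v < n].

Definition face a b t : bool :=
  if excluded_middle_informative (I 'X_[interval_exponent a b t])
  then false else true.

Lemma faceP a b t : reflect (~ I 'X_[interval_exponent a b t]) (face a b t).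
Proof.
by rewrite /face; case: excluded_middle_informative => H; constructor; tauto.
Qed.

(** The weights suppress the removal of points of [B], leaving the simplicial coboundary on subsets
    of W up to the signs caused by [B]. *)
Definition kdW := kd (fun v => (v \in W)%:R : K) (V := K^o).

(** Cardinalities [#|B| + 2] and [#|B| + 3] encode edges and triangles of W. Values on non-faces are
    arbitrary rather than 0. *)
Definition H1_trivial a b : Prop := forall c : {set 'I_n} -> K^o,
  (forall t, B \subset t -> #|t| = (#|B| + 3)%N -> face a b t -> kdW c t = 0) ->
  exists p : {set 'I_n} -> K^o,
    forall t, B \subset t -> #|t| = (#|B| + 2)%N -> face a b t -> c t = kdW p t.

Lemma face_le a b a' b' s t :
  (forall v, (if v \in s then b v else a v) <= (if v \in t then b' v else a' v))%N ->
  face a' b' t -> face a b s.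
Proof.
move=> le /faceP Ht; apply/faceP => Hs; apply: Ht.
apply: (ideal_monomial_le Iid Hs); apply/mnm_lepP => v; rewrite !mnmE.
by case: ifP.
Qed.

Lemma face_sub a b s t : (forall v, (a v <= b v)%N) -> s \subset t ->
  face a b t -> face a b s.
Proof.
move=> le_ab st; apply: face_le => v.
by case: ifP => [/(subsetP st)->//|_]; case: ifP.
Qed.

Definition upd a i k : 'I_n -> nat := fun v => if v == i then k else a v.

(* The long exact sequence of the triple of links of i for the values
   a i <= k <= b i. *)
Lemma H1_trivial_split a b i k : (forall v, (a v <= b v)%N) ->
  (a i <= k <= b i)%N ->
  H1_trivial a (upd b i k) -> H1_trivial (upd a i k) b -> H1_trivial a b.
Proof.
move=> le_ab /andP[le_ak le_kb] Hlo Hhi c cZ.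
have face_hi t : face (upd a i k) b t -> face a b t.
  apply: face_le => v; rewrite /upd.
  by case: ifP => // _; case: eqP => // ->.
have face_lo t : face a b t -> face a (upd b i k) t.
  apply: face_le => v; rewrite /upd.
  by case: ifP => // _; case: eqP => // ->.
have [|p Dp] := Hhi c; first by move=> t Bt t3 /face_hi; apply: cZ.
(* The corrected cochain vanishes on edges of the upper complex; extended by 0 outside the faces for
   (a, b), it becomes a cochain of the lower complex. *)
pose c1 t : K^o := if face a b t then c t - kdW p t else 0.
have [|q Dq] := Hlo c1; last first.
  exists (fun t => q t + p t) => t Bt t2 ft.
  rewrite [RHS]kdD -/kdW; have := Dq t Bt t2 (face_lo t ft); rewrite /c1 ft => <-.
  by rewrite subrK.
move=> t Bt t3 ft.
(* If [i] is in [t], every edge of [t] that is a face for (a, b) is a face for ([upd a i k], b),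
   where [p] already solves the problem. Otherwise [t] itself is a face for (a, b). *)
have [it|it] := boolP (i \in t).
  apply: big1 => v vt; have [vW|vW] := boolP (v \in W); last by rewrite mulr0 scale0r.
  rewrite [c1 _](_ : _ = 0) ?scaler0 // /c1; case: ifP => // fv.
  rewrite (Dp (t :\ v)) ?subrr //.
  - by rewrite subsetD1 Bt inE vW.
  - by move: t3; rewrite (cardsD1 v) vt; lia.
  have [E|vi] := eqVneq v i.
    apply: face_le ft => w; rewrite /upd !inE E.
    by case: (w =P i) => [->|_] /=; rewrite ?it.
  apply: face_le fv => w; rewrite /upd !inE.
  by case: (w =P i) => [->|_] //=; rewrite eq_sym vi it.
have ft' : face a b t.
  by apply: face_le ft => w; rewrite /upd; case: (w =P i) => // ->; rewrite (negPf it).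
rewrite /kdW (@eq_kd _ _ _ _ _ (fun s => c s - kdW p s)).
  by rewrite kdB [X in _ - X]kd_kd subr0; apply: cZ.
by move=> v vt; rewrite /c1 (face_sub le_ab (subD1set t v) ft').
Qed.

Lemma interval_exponentD1 a b t v : v \in t -> v \in W -> b v = (a v).+1 ->
  interval_exponent a b t = (U_(v) + interval_exponent a b (t :\ v))%MM.
Proof.
move=> vt vW Eb; apply/mnmP => w; rewrite mnmDE !mnmE !inE.
case: (w =P v) => [->|/eqP wv] /=; first by rewrite eqxx vW vt Eb.
by rewrite eq_sym (negPf wv).
Qed.

Lemma mdeg_interval_exponent a t : B \subset t ->
  mdeg (interval_exponent a (fun v => (a v).+1) t)
  = (\sum_(v in W) a v + (#|t| - #|B|))%N.
Proof.
move=> Bt; rewrite mdegE.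
have -> : (#|t| - #|B|)%N = (\sum_(v in W) (v \in t))%N.
  rewrite -(cardsID B t) (setIidPr Bt) addKn -sum1_card big_mkcond [RHS]big_mkcond.
  by apply: eq_bigr => v _; rewrite !inE negbK; case: (v \in W); case: (v \in t).
rewrite -big_split [RHS]big_mkcond; apply: eq_bigr => v _; rewrite mnmE /=.
by case: (v \in W) => //; case: (v \in t); rewrite ?addn1 ?addn0.
Qed.

(* A non-face t with #|t| = #|B| + 3 contains a non-face of size #|B| + 2, so the
   coboundary of a lifted cocycle lies in I_<d> and not only in I. *)
Lemma H1_trivial_unit a : H1_trivial a (fun v => (a v).+1).
Proof.
move=> c cZ; pose e := interval_exponent a (fun v => (a v).+1).
pose D := (\sum_(v in W) a v)%N.
(* The degree of the monomials attached to edges. *)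
pose d := D.+2; pose J := degree_component_ideal I d.
have JI f : J f -> I f by apply: ideal_gen_sub => // g [].
have Jid : is_ideal J := ideal_gen_ideal _.
have deg_e t k : B \subset t -> #|t| = (#|B| + k)%N -> mdeg (e t) = (D + k)%N.
  by move=> Bt tk; rewrite mdeg_interval_exponent // tk addKn.
pose P t : R^o := if (B \subset t) && (#|t| == #|B| + 2)%N then c t *: 'X_[e t] else 0.
have P0 t : #|t| <> (#|B| + 2)%N -> P t = 0.
  by rewrite /P => /eqP/negPf->; rewrite andbF.
have kdP t : B \subset t -> #|t| = (#|B| + 3)%N -> kd X P t = kdW c t *: 'X_[e t].
  move=> Bt t3; rewrite /kdW /kd scaler_suml; apply: eq_bigr => v vt.
  rewrite -[_ *: P _]/(_ * _) -[_ *: c _]/(_ * _) /P subsetD1 Bt inE negbK.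
  have [vW|vW] /= := boolP (v \in W); last by rewrite !mulr0 mul0r scale0r.
  have -> : #|t :\ v| == (#|B| + 2)%N.
    by move: t3; rewrite (cardsD1 v) vt => E; apply/eqP; lia.
  rewrite /e (interval_exponentD1 vt) // mpolyXD mulr1.
  rewrite -scalerAr -[in LHS]signr_odd -[in RHS]signr_odd; case: (odd _).
    by rewrite expr1 !mulN1r mulNr scalerN scaleNr.
  by rewrite expr0 !mul1r.
have JP t : J (kd X P t).
  have J0 : J 0 by case: Jid.
  have [Bt|nBt] := boolP (B \subset t); last first.
    rewrite kd0 // => v vt; rewrite /P subsetD1; by rewrite (negPf nBt).
  have [t3|t3] := eqVneq #|t| (#|B| + 3)%N; last first.
    rewrite kd0 // => v vt; apply: P0 => E; move/eqP: t3; apply.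
    by rewrite (cardsD1 v) vt E; lia.
  rewrite kdP //; have [ft|/faceP/NNPP It] := boolP (face a (fun v => (a v).+1) t).
    by rewrite cZ // scale0r.
  have [u [Iu le_u u2]] := support_two_le It.
  (* The support of [u] has two elements and [t :&: W] has three, so [u] still divides the monomial
     of the edge [t :\ v] for some [v]. *)
  have [v /setIP[vt vW] uv] : exists2 v, v \in t :&: W & u v = 0%N.
    apply: NNPP => H; suff /subset_leq_card : t :&: W \subset msupport u.
      rewrite u2; have := cardsID B t; rewrite (setIidPr Bt) t3 setDE setCK.
      by move=> /addnI->.
    apply/subsetP => v vtW; rewrite inE; apply/eqP => uv; apply: H; by exists v.
  have Et := @interval_exponentD1 a (fun v => (a v).+1) t v vt vW erefl.
  apply: idealZ => //; rewrite /e Et mpolyXD; case: Jid => _ _; apply.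
  apply: ideal_gen_mem; split; last first.
    rewrite dhomogX /= (deg_e _ 2) ?addn2 // ?subsetD1 ?Bt ?inE ?vW //.
    by move: t3; rewrite (cardsD1 v) vt; lia.
  apply: (ideal_monomial_le Iid (min_gens_mem Iu)); apply/mnm_lepP => w.
  have [->|wv] := eqVneq w v; first by rewrite uv.
  have /mnm_lepP/(_ w) := le_u; rewrite Et mnmDE mnm1E.
  by rewrite [v == w]eq_sym (negPf wv).
have I0 f : I f -> f@_0 = 0.
  move=> If; apply/eqP/negPn/negP => f0.
  have [u [_ /mnm_lepP le_u u2]] := support_two_le ((monomial_idealP Imon f).1 If _ f0).
  move/eqP: u2; rewrite (_ : msupport u = set0) ?cards0 //.
  apply/setP => v; rewrite !inE; move: (le_u v); rewrite mnm0E leqn0 => /eqP->.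
  by rewrite eqxx.
have PT : (P setT : R)@_0 = 0.
  rewrite /P; case: ifP => [/andP[Bt /eqP t2]|_]; last by rewrite mcoeff0.
  rewrite mcoeffZ mcoeffX; case: eqP => [E|]; last by rewrite mulr0.
  by have := deg_e _ _ Bt t2; rewrite E mdeg0 addn2.
have [Q JQ] : exists Q : {set 'I_n} -> R^o, forall t, J (P t - kd X Q t).
  have [Jnz|J0] := classic (nonzero_ideal J); last first.
    have [t|//|Q DQ] := @koszul_exact _ _ P.
      by apply: NNPP => /eqP H; apply: J0; exists (kd X P t).
    by exists Q => t; rewrite DQ subrr; case: Jid.
  have [_ _ [r r_init [F [FJ Fle _]]]] := Icl.2 d Jnz.
  have le_rd : (r <= d)%N.
    have [g [s sI Dg] g0] := Jnz.
    have [p ps /eqP p0] : exists2 p, p \in s & p.2 <> 0.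
      apply: NNPP => H; case/eqP: g0; rewrite Dg big_seq big1 // => p ps.
      rewrite [p.2](_ : _ = 0) ?mulr0 //; apply: NNPP => p0; apply: H; by exists p.
    apply: (r_init.2 p.2 d) => //; last by case: (sI p ps).
    exact/ideal_gen_mem/sI.
  have W_n := cardsC W; rewrite card_ord in W_n.
  (* The extra points of [B] put edges in cochain degree [#|B| + 2]; the base degree is lowered by
     [#|B|] to compensate. *)
  apply: (@linear_resolution_chase _ _ J F r%:Z FJ _ (#|B| + 2) P (D%:Z - #|B|%:Z)) => //.
  - move=> i k; apply: Fle; rewrite /betti -lt0n; apply/card_gt0P; exists k.
    by rewrite inE.
  - move=> t; rewrite /P; case: ifP => [/andP[Bt /eqP t2]|_]; last exact: in_degree0.
    rewrite (_ : D%:Z - #|B|%:Z + #|t|%:Z = (D + 2)%N%:Z); last by rewrite t2; lia.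
    by rewrite /= dhomogZ // dhomogX /= (deg_e _ 2).
  - by rewrite /d in le_rd; lia.
  - by lia.
  - by move=> f /JI/I0.
(* The monomial of a face [t] is not in I, so comparing its coefficients in [P t] and [kd X Q t]
   gives the vertex cochain. *)
exists (fun s => (Q s : R)@_(e s)) => t Bt t2 ft.
have PQ : (P t : R)@_(e t) = (kd X Q t : R)@_(e t).
  apply/eqP; rewrite -subr_eq0 -mcoeffB; apply/negPn/negP => H.
  by have /faceP := ft; apply; apply: (monomial_idealP Imon _).1 (JI _ (JQ t)) _ H.
move: PQ; rewrite {1}/P Bt t2 eqxx /= mcoeffZ mcoeffX eqxx mulr1 => ->.
rewrite raddf_sum /=; apply: eq_bigr => v vt.
rewrite -[_ *: Q _]/(_ * _) -[_ *: _@_ _]/(_ * _) -!mulrA.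
rewrite -[in LHS]signr_odd -[in RHS]signr_odd.
have EQ : ('X_v * (Q (t :\ v) : R))@_(e t) = (v \in W)%:R * (Q (t :\ v) : R)@_(e (t :\ v)).
  have [vW|vW] := boolP (v \in W); last first.
    by rewrite mcoeffXM0 ?mul0r // /e mnmE (negPf vW).
  by rewrite /e (interval_exponentD1 vt) // addmC mcoeffXM mul1r.
by case: (odd _); rewrite ?expr1 ?expr0 ?mulN1r ?mul1r ?mcoeffN EQ.
Qed.

(** Induction on the total length: a coordinate of length more than one is split at [(a i).+1],
    until only unit steps remain. *)
Lemma H1_trivial_interval a b : (forall v, (a v < b v)%N) -> H1_trivial a b.
Proof.
have [k] := ubnP (\sum_v (b v - a v))%N; elim: k a b => // k IHk a b lt_k lt_ab.
have [/forallP E|] := boolP [forall v, b v == (a v).+1].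
  rewrite (_ : b = fun v => (a v).+1); first exact: H1_trivial_unit.
  by apply: functional_extensionality => v; apply/eqP.
rewrite negb_forall => /existsP[i ne_i].
have lt_i : ((a i).+1 < b i)%N by rewrite ltn_neqAle eq_sym ne_i lt_ab.
apply: (@H1_trivial_split a b i (a i).+1) => [v|||].
- exact: ltnW.
- by rewrite leqnSn ltnW.
- apply: IHk => [|v]; last by rewrite /upd; case: eqP => [->|].
  rewrite (leq_trans _ (ltnSE lt_k)) // (bigD1 i) //= [X in (_ < X)%N](bigD1 i) //=.
  rewrite /upd eqxx (eq_bigr (fun v => b v - a v)%N) => [|v /negPf->//].
  by rewrite ltn_add2r; lia.
- apply: IHk => [|v]; last by rewrite /upd; case: eqP => [->|].
  rewrite (leq_trans _ (ltnSE lt_k)) // (bigD1 i) //= [X in (_ < X)%N](bigD1 i) //=.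
  rewrite /upd eqxx (eq_bigr (fun v => b v - a v)%N) => [|v /negPf->//].
  by rewrite ltn_add2r; lia.
Qed.

End IntervalComplexes.

(** * The base graph and bridges of its complement *)

Section BridgeProperty.
Variables (K : fieldType) (n : nat) (I : {mpoly K[n]} -> Prop).
Hypothesis I2 : support_two_monomial_ideal I.
Hypothesis Icl : componentwise_linear I.
Implicit Types (u v w : 'I_n).

Let Imon : monomial_ideal I := proj1 I2.
Let Iid : is_ideal I := monomial_ideal_is_ideal Imon.

Definition edge u v : bool :=
  if excluded_middle_informative (base_graph I u v) then true else false.

Lemma edgeP u v : reflect (base_graph I u v) (edge u v).
Proof. by rewrite /edge; case: excluded_middle_informative => H; constructor. Qed.

Lemma edge_irrefl u : edge u u = false.
Proof. by apply/edgeP => -[]. Qed.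

Lemma edge_sym u v : edge u v = edge v u.
Proof.
by apply/edgeP/edgeP => -[ne [m mI ms]]; split=> [/esym//|];
  exists m => //; rewrite setUC.
Qed.

(** A minimal generator dividing [m] involves exactly two variables, which can only be [u] and [v];
    in particular these differ. *)
Lemma edge_of_monomial u v (m : 'X_{1..n}) : I 'X_[m] ->
  (forall w, m w != 0%N -> w = u \/ w = v) -> edge u v.
Proof.
move=> Im sm; have [g [gI /mnm_lepP le_g g2]] := support_two_le I2 Im.
have sub : msupport g \subset [set u; v].
  apply/subsetP => w; rewrite !inE => gw; apply/orP.
  have /sm[->|->] : m w != 0%N by rewrite -lt0n (leq_trans _ (le_g w)) // lt0n.
    by left.
  by right.
have uv : u != v.
  apply: contraTneq (subset_leq_card sub) => ->.
  by rewrite g2 setUid cards1.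
apply/edgeP; split; first exact/eqP.
by exists g => //; apply/eqP; rewrite eqEcard sub g2 cards2 uv.
Qed.

(** Finitely many pairs allow a common exponent, beyond which no face of the complex from 0 contains
    an edge of the base graph. *)
Lemma edge_power : exists k, forall u v, edge u v ->
  I 'X_[(U_(u) + U_(v)) *+ k].
Proof.
have /fin_all_exists[F FP] (p : 'I_n * 'I_n) : exists k, edge p.1 p.2 ->
    forall l, (k <= l)%N -> I 'X_[(U_(p.1) + U_(p.2)) *+ l].
  case: p => u v /=; have [/edgeP[_ [g gI gs]]|_] := boolP (edge u v); last by exists 0%N.
  exists (mdeg g) => _ l le_l.
  apply: (ideal_monomial_le Iid (min_gens_mem gI)); apply/mnm_lepP => w.
  rewrite mulmnE mnmDE !mnm1E; have [->//|gw] := eqVneq (g w) 0%N.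
  have : w \in msupport g by rewrite inE.
  rewrite gs !inE [w == u]eq_sym [w == v]eq_sym => uvw.
  have le_g : (g w <= l)%N by rewrite (leq_trans _ le_l) // mdegE (bigD1 w) //= leq_addr.
  by rewrite (leq_trans le_g) // leq_pmull // addn_gt0 !lt0b.
exists (\max_p F p)%N => u v uv; apply: (FP (u, v)) => //.
exact: leq_bigmax.
Qed.

(* Removing the edge u0 v0 of the complement disconnects u0 from v0 in W. *)
Lemma bridge (W : {set 'I_n}) u0 v0 : u0 \in W -> v0 \in W -> (2 < #|W|)%N ->
  u0 != v0 -> ~~ edge u0 v0 ->
  (forall w, w \in W -> w != u0 -> w != v0 -> edge u0 w || edge v0 w) ->
  exists2 p : 'I_n -> K, p u0 != p v0 &
    forall u v, u \in W -> v \in W -> u != v -> ~~ edge u v ->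
      [set u; v] != [set u0; v0] -> p u = p v.
Proof.
move=> u0W v0W W3 ne0 nedge0 noedge; set B := ~: W.
(* The successor keeps the interval from 0 strict even when [k] is 0. *)
have [k Ik] := edge_power; pose b (_ : 'I_n) := k.+1.
have Hb := H1_trivial_interval I2 Icl W3 (a := fun => 0%N) (b := b) (fun=> ltn0Sn k).
(* The indicator of the edge [u0 v0] is a cocycle because no triangle of the complement in [W]
   contains this edge. *)
pose c t : K^o := (t == B :|: [set u0; v0])%:R.
have cardB u v : u \in W -> v \in W -> u != v -> #|B :|: [set u; v]| = (#|B| + 2)%N.
  move=> uW vW uv; rewrite cardsU cards2 uv (_ : _ :&: _ = set0) ?cards0 ?subn0 //.
  apply/setP => w; rewrite !inE; apply/negP => /andP[wW /orP[]/eqP E].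
    by rewrite E uW in wW.
  by rewrite E vW in wW.
have [|p Dp] := Hb c.
  move=> t Bt t3 ft; apply: big1 => v vt.
  have [vW|vW] := boolP (v \in W); last by rewrite mulr0 scale0r.
  rewrite /c; case: eqP => [E|_]; last by rewrite scaler0.
  have u0t : u0 \in t :\ v by rewrite E !inE eqxx orbT.
  have v0t : v0 \in t :\ v by rewrite E !inE eqxx !orbT.
  move: u0t v0t; rewrite !inE => /andP[vu0 u0t] /andP[vv0 v0t].
  have H u w : u \in t -> w \in t -> u \in W -> w \in W -> u != w -> ~~ edge u w.
    move=> ut wt uW wW uw; apply/negP => /Ik Iuw; have /faceP := ft; apply.
    apply: (ideal_monomial_le Iid Iuw); apply/mnm_lepP => z.
    rewrite mulmnE mnmDE !mnm1E mnmE.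
    have [<-|uz] := eqVneq u z; first by rewrite uW ut [w == u]eq_sym (negPf uw) mul1n.
    by have [<-|wz] := eqVneq w z; rewrite ?wW ?wt ?mul1n.
  have : edge u0 v || edge v0 v by apply: noedge; rewrite // eq_sym.
  by rewrite (negPf (H u0 v _ _ _ _ _)) ?(negPf (H v0 v _ _ _ _ _)) // eq_sym.
(* Absorbing the signs due to [B] turns [kdW p] on an edge into a difference of values of [q], up to
   sign. *)
pose q u : K := (-1) ^+ nbelow u B * (p (u |: B) : K).
have Dq u v : u \in W -> v \in W -> u != v -> ~~ edge u v ->
    exists s : nat, ([set u; v] == [set u0; v0])%:R = (-1) ^+ s * (q u - q v) :> K.
  move=> uW vW uv nedge; set t := B :|: [set u; v].
  have ft : face I W (fun=> 0%N) b t.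
    apply/faceP => It; move/negP: nedge; apply.
    apply: (edge_of_monomial It) => w; rewrite mnmE; case: ifP => // wW.
    rewrite !inE wW /=; case: (w =P u) => [->|_]; first by left.
    by case: (w =P v) => [->|_]; [right|].
  have := Dp t (subsetUl _ _) (cardB _ _ uW vW uv) ft.
  have -> : c t = ([set u; v] == [set u0; v0])%:R.
    rewrite /c; congr (_%:R); congr nat_of_bool; apply/eqP/eqP => [E|E]; last by rewrite /t E.
    have := congr1 (fun s => s :&: W) E; rewrite !setIUl.
    rewrite (_ : B :&: W = set0) ?set0U; last by rewrite setIC setICr.
    by rewrite !(setIidPl _) // sub1set.
  have ut : u \in t by rewrite !inE eqxx orbT.
  have vt : v \in t by rewrite !inE eqxx !orbT.
  have tu : t :\ u = v |: B.
    apply/setP => w; rewrite !inE; case: (w =P u) => [->|/=].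
      by rewrite (negPf uv) uW.
    by case: eqP; rewrite ?orbT ?orbF.
  have tv : t :\ v = u |: B.
    apply/setP => w; rewrite !inE; case: (w =P v) => [->|/=].
      by rewrite eq_sym (negPf uv) vW.
    by case: eqP; rewrite ?orbT ?orbF.
  move->; rewrite /kdW /kd (bigD1 u) //= (bigD1 v) /=; last by rewrite vt eq_sym.
  rewrite big1 ?addr0; last first.
    move=> w /andP[/andP[]]; rewrite !inE => wt wu wv.
    move: wt; rewrite (negPf wu) (negPf wv) !orbF => /negPf->.
    by rewrite mulr0 scale0r.
  rewrite uW vW !mulr1 tu tv (@nbelowD1 _ u v t) // (@nbelowD1 _ v u t) // tu tv.
  rewrite !nbelowU1 ?inE ?uW ?vW // !ltnn !add0n.
  rewrite -![_ *: _]/(_ * _) /q.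
  exists ((u < v)%N + nbelow u B + nbelow v B)%N.
  have uv' : (u != v :> nat) by [].
  have sq k' : ((-1) ^+ k' * (-1) ^+ k' = 1 :> K) by rewrite -expr2 sqrr_sign.
  have := sq (nbelow u B); have := sq (nbelow v B).
  rewrite !exprD; move: ((-1) ^+ nbelow u B) ((-1) ^+ nbelow v B) => x y yy xx.
  have E s a c' : s * x * y * (x * a - y * c') = s * (y * a - x * c').
    transitivity (s * (x * x * (y * a) - y * y * (x * c'))); first by ring.
    by rewrite xx yy !mul1r.
  by case: ltngtP uv' => // _ _; rewrite /= ?expr1 ?expr0 E; ring.
exists q => [|u v uW vW uv nedge ne].
  have [s] := Dq u0 v0 u0W v0W ne0 nedge0; rewrite eqxx => E.
  by apply/eqP => Eq; move/eqP: E; rewrite Eq subrr mulr0 oner_eq0.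
have [s] := Dq u v uW vW uv nedge; rewrite (negPf ne) => /esym/eqP.
by rewrite mulf_eq0 signr_eq0 subr_eq0 => /eqP.
Qed.

End BridgeProperty.

(** * Simplicial vertices from bridges *)

Section Dirac.
Variables (K : fieldType) (V : finType) (e : rel V).
Hypothesis e_irr : forall u, e u u = false.
Hypothesis e_sym : forall u v, e u v = e v u.
Hypothesis bridge_e : forall (W : {set V}) u0 v0,
  u0 \in W -> v0 \in W -> (2 < #|W|)%N -> u0 != v0 -> ~~ e u0 v0 ->
  (forall w, w \in W -> w != u0 -> w != v0 -> e u0 w || e v0 w) ->
  exists2 p : V -> K, p u0 != p v0 &
    forall u v, u \in W -> v \in W -> u != v -> ~~ e u v ->
      [set u; v] != [set u0; v0] -> p u = p v.

(** Here [e] stands for the base graph, while simplicial refers to its complement: the complement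
    neighbours of [s] form a clique of the complement. *)
Definition simplicial (S : {set V}) s : Prop := forall x y, x \in S -> y \in S ->
  x != s -> y != s -> ~~ e s x -> ~~ e s y -> ~~ e x y.

Lemma set2_neq (x u v a b : V) : x \in [set u; v] -> x != a -> x != b ->
  [set u; v] != [set a; b].
Proof.
by move=> xuv xa xb; apply: contraTneq xuv => ->; rewrite !inE (negPf xa) (negPf xb).
Qed.

(* Dirac's induction: the neighbourhood T of a component C of the non-neighbours of
   a is a clique, since for non-adjacent t, t' in T the edge a t would lie on a
   cycle through C and t' although it is a bridge. *)
Lemma simplicial_nonneighbour (S : {set V}) a b : a \in S -> b \in S -> e a b ->
  exists2 s, s \in S /\ e a s & simplicial S s.
Proof.
have [k] := ubnP #|S|; elim: k S a b => // k IHk S a b lt_k aS bS eab.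
pose N := [set x in S | e a x].
pose r x y := [&& x \in N, y \in N & ~~ e x y].
pose C := [set x | connect r b x].
have bC : b \in C by rewrite inE connect0.
have rC x y : r x y -> (x \in C) = (y \in C).
  move=> rxy; rewrite !inE; apply/idP/idP => bx.
    by apply: connect_trans bx (connect1 _).
  by apply: connect_trans bx (connect1 _); rewrite /r e_sym andbCA.
have CN x : x \in C -> x \in N.
  rewrite inE => bx; have rN : closed r (mem N) by move=> u v /and3P[-> ->].
  by rewrite -(closed_connect rN bx) !inE bS eab.
have aC : a \notin C by apply/negP => /CN; rewrite inE e_irr andbF.
pose T := [set t in S | (t \notin C) && [exists x in C, ~~ e t x]].
have aT t : t \in T -> ~~ e a t.
  rewrite inE => /and3P[tS tC /exists_inP[x xC etx]]; apply: contra tC => eat.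
  by rewrite -(rC x) // /r CN // inE tS eat e_sym.
have Ta t : t \in T -> t != a.
  rewrite inE => /and3P[tS tC /exists_inP[x /CN xN etx]]; apply: contraNneq etx => ->.
  by move: xN; rewrite inE => /andP[].
have T_clique t t' : t \in T -> t' \in T -> ~~ e t t'.
  move=> tT t'T; apply/negP => ett'.
  have ne_tt' : t != t' by apply: contraTneq ett' => ->; rewrite e_irr.
  pose W := C :|: [set a; t; t'].
  have CW x : x \in C -> x \in W by move=> xC; rewrite in_setU xC.
  have [aW tW t'W] : [/\ a \in W, t \in W & t' \in W].
    by rewrite !inE !eqxx !orbT.
  (* In the complement [a] and [t] have no common neighbour in [W]: points of [C] are not adjacent
     to [a], and [t'] is not adjacent to [t]. *)
  have [|||w|p pat pE] := @bridge_e W a t aW tW.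
  - have : [set a; t; t'] \subset W by apply: subsetUr.
    move=> /subset_leq_card; apply: leq_trans.
    rewrite setUC cardsU1 cards2 !inE negb_or (Ta t') //.
    by rewrite [t' == t]eq_sym ne_tt' [a == t]eq_sym (Ta t).
  - by rewrite eq_sym Ta.
  - exact: aT.
  - move=> /setUP[/CN wN|wS] wa wt; first by move: wN; rewrite inE => /andP[_ ->].
    by move: wS; rewrite !inE (negPf wa) (negPf wt) => /eqP->; rewrite ett' orbT.
  (* Connectedness makes [p] constant on [C], neighbours in [C] extend this to [t] and [t'], and the
     complement edge [a t'] then contradicts [p a != p t]. *)
  have pC x : x \in C -> p x = p b.
    pose A := [pred y | (y \in C) && (p y == p b)].
    rewrite inE => bx; suff rA : closed r A.
      have : b \in A by rewrite inE bC eqxx.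
      by rewrite (closed_connect rA bx) => /andP[_ /eqP].
    move=> u v ruv; rewrite [LHS]inE [RHS]inE /= (rC u v) //.
    have [vC|//] := boolP (v \in C); have uC : u \in C by rewrite (rC u v).
    have [->//|ne_uv] := eqVneq u v; have /and3P[_ _ euv] := ruv.
    rewrite (pE u v) ?CW //; apply: (@set2_neq u); first by rewrite !inE eqxx.
      by apply: contraNneq aC => <-.
    by apply: contraTneq uC => ->; move: tT; rewrite inE => /and3P[].
  have pT x : x \in T -> x \in W -> p x = p b.
    move=> xT xW; have := xT; rewrite inE => /and3P[_ xC /exists_inP[y yC exy]].
    have xy : x != y by apply/eqP => E; rewrite E yC in xC.
    rewrite -(pC y yC) (pE x y) ?(CW y) //.
    apply: (@set2_neq y); first by rewrite !inE eqxx orbT.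
      by apply: contraNneq aC => <-.
    by apply: contraTneq yC => ->; move: tT; rewrite inE => /and3P[].
  move/eqP: pat; apply; rewrite (pT t) // -(pT t') // (pE a t') //.
  - by rewrite eq_sym Ta.
  - exact: aT.
  - by apply: (@set2_neq t'); rewrite ?Ta // ?inE ?eqxx ?orbT // eq_sym.
pose S' := C :|: T.
have S'S : S' \subset S.
  apply/subsetP => x; rewrite inE => /orP[/CN|]; rewrite inE => /andP[] //.
have lt_S' : (#|S'| < k)%N.
  rewrite -ltnS; apply: leq_trans lt_k; rewrite ltnS; apply: proper_card.
  apply/properP; split=> //; exists a => //; rewrite inE (negPf aC) /=.
  by apply/negP => /Ta; rewrite eqxx.
(* The recursion from an [e]-edge at [x] returns a vertex [e]-adjacent to [x]. It avoids [T] if [x]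
   is in [T], by [T_clique], and also if no point of [T] has an [e]-edge in [S']. With no [e]-edge
   in [S'] at all, [b] serves. *)
have [s sC sS'] : exists2 s, s \in C & simplicial S' s.
  have [/exists_inP[x xT /exists_inP[y yS' exy]]|nT] :=
      boolP [exists x in T, exists y in S', e x y].
    have [|s [sS' exs] ss] := IHk _ x y lt_S' _ yS' exy; first by rewrite inE xT orbT.
    exists s => //; move: sS'; rewrite inE => /orP[//|sT].
    by rewrite (negPf (T_clique x s xT sT)) in exs.
  have nT' x y : x \in T -> y \in S' -> ~~ e x y.
    move=> xT yS'; apply: contra nT => exy.
    by apply/exists_inP; exists x => //; apply/exists_inP; exists y.
  have [/exists_inP[x xC /exists_inP[y yS' exy]]|nC] :=
      boolP [exists x in C, exists y in S', e x y].
    have xS' : x \in S' by rewrite inE xC.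
    have [s [sS' exs] ss] := IHk _ x y lt_S' xS' yS' exy.
    exists s => //; move: sS'; rewrite inE => /orP[//|sT].
    by have := nT' s x sT xS'; rewrite e_sym exs.
  exists b => // x y xS' yS' _ _ _ _; move: xS'; rewrite inE => /orP[xC|xT]; last exact: nT'.
  by apply: contra nC => exy; apply/exists_inP; exists x => //; apply/exists_inP; exists y.
exists s; first by move: (CN s sC); rewrite inE => /andP[].
(* All complement neighbours of [s] lie in [C] or [T], so simplicial in [S'] implies simplicial in
   [S]. *)
have inS' x : x \in S -> x != s -> ~~ e s x -> x \in S'.
  move=> xS xs esx; rewrite inE; have [//|xC] := boolP (x \in C).
  by rewrite inE xS xC /=; apply/exists_inP; exists s => //; rewrite e_sym.
by move=> x y xS yS xs ys esx esy; apply: sS' => //; apply: inS'.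
Qed.

Lemma exists_simplicial (S : {set V}) : S != set0 ->
  exists2 s, s \in S & simplicial S s.
Proof.
move=> /set0Pn[b bS].
have [/exists_inP[x xS /exists_inP[y yS exy]]|nS] :=
    boolP [exists x in S, exists y in S, e x y].
  by have [s [sS _] ss] := simplicial_nonneighbour xS yS exy; exists s.
exists b => // x y xS yS _ _ _ _; apply: contra nS => exy.
by apply/exists_inP; exists x => //; apply/exists_inP; exists y.
Qed.

End Dirac.

(** * Chordality of the complement *)

Section Chordality.
Variables (K : fieldType) (n : nat) (I : {mpoly K[n]} -> Prop).
Hypothesis I2 : support_two_monomial_ideal I.
Hypothesis Icl : componentwise_linear I.

Lemma complement_chordal : chordal (graph_compl (base_graph I)).
Proof.
case=> // m c m3 [c_inj cE].
have adjE (i j : 'I_m.+1) : (c i != c j) && ~~ edge I (c i) (c j)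
    = (j == ordS i) || (i == ordS j).
  apply/idP/idP => [/andP[/eqP ne /edgeP nb]|H].
    by have [->|->] := (cE i j).1 (conj ne nb); rewrite eqxx ?orbT.
  have [|ne nb] := (cE i j).2; first by case/orP: H => /eqP->; [left|right].
  by apply/andP; split; [exact/eqP|exact/edgeP].
have ordSE (i j : 'I_m.+1) : (j == ordS i) = (nat_of_ord j == i.+1 %% m.+1)%N by [].
have c_eq i j : (c i == c j) = (i == j) by exact: inj_eq.
pose o k : 'I_m.+1 := inord k.
have oE k : (k < m.+1)%N -> nat_of_ord (o k) = k by exact: inordK.
pose W := [set c i | i : 'I_m.+1].
have cW i : c i \in W by apply: imset_f.
have next k : (k < m)%N -> (c (o k) != c (o k.+1)) && ~~ edge I (c (o k)) (c (o k.+1)).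
  move=> lt_k; rewrite adjE ordSE !oE ?modn_small ?eqxx //; exact: leqW.
have last_next : (c (o m) != c (o 0)) && ~~ edge I (c (o m)) (c (o 0)).
  by rewrite adjE ordSE !oE // modnn eqxx.
have /andP[ne01 e01] := next 0%N (ltn_trans (isT : (0 < 2)%N) (ltnSE m3)).
have [|w|p p01 pE] := @bridge _ _ _ I2 Icl W (c (o 0)) (c (o 1)) (cW _) (cW _) _ ne01 e01.
- by rewrite card_imset // card_ord; apply: leq_trans m3.
- move=> /imsetP[k _ ->]; rewrite !c_eq => k0 k1; apply/negPn/negP.
  rewrite negb_or => /andP[e0 e1].
  have : (c (o 0) != c k) && ~~ edge I (c (o 0)) (c k) by rewrite c_eq eq_sym k0.
  have : (c (o 1) != c k) && ~~ edge I (c (o 1)) (c k) by rewrite c_eq eq_sym k1.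
  rewrite !adjE !ordSE !oE //; last exact: leq_trans m3.
  have {k0}k0 : nat_of_ord k <> 0%N by move=> E; case/eqP: k0; apply: val_inj; rewrite /= oE.
  have {k1}k1 : nat_of_ord k <> 1%N.
    move=> E; case/eqP: k1; apply: val_inj; rewrite /= oE //; exact: leq_trans m3.
  have [lt_k|] := ltnP k.+1 m.+1; last first.
    have := ltn_ord k => lt1 lt2; have -> : k.+1 = m.+1 by lia.
    by rewrite modnn !modn_small //; lia.
  by rewrite !modn_small //; lia.
have ne2 k j : (1 < k < m.+1)%N -> [set c (o k); c (o j)] != [set c (o 0); c (o 1)].
  move=> /andP[k1 km]; apply: (@set2_neq _ (c (o k))); rewrite ?inE ?eqxx // c_eq.
    by apply/eqP => /(congr1 val); rewrite /= !oE //; lia.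
  by apply/eqP => /(congr1 val); rewrite /= !oE //; lia.
(* The path from c_1 to c_m avoids the edge c_0 c_1, so [p] is constant along it; the closing edge
   c_m c_0 then contradicts [p01]. *)
have pc k : (0 < k <= m)%N -> p (c (o k)) = p (c (o 1)).
  elim: k => // -[|k] IHk /andP[_ km] //.
  rewrite -IHk; last exact: ltnW.
  have /andP[ne ek] := next k.+1 km.
  apply/esym/pE => //; rewrite setUC; apply: ne2; exact: km.
case/eqP: p01; rewrite -(pc m); last by rewrite leqnn andbT; lia.
have /andP[ne el] := last_next.
by apply/esym/pE => //; apply: ne2; rewrite ltnSn andbT; lia.
Qed.

End Chordality.

(** * Linear complexes and regularity *)

Section LinearComplexes.
Variables (K : fieldType) (n : nat).
Local Notation R := {mpoly K[n]}.
Implicit Types (J : R -> Prop) (F : free_complex K n).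

Definition mxhomog d p q (M : 'M[R]_(p, q)) : Prop :=
  forall i j, M i j \is d.-homog.

Lemma mxhomog0 d p q : mxhomog d (0 : 'M_(p, q)).
Proof. by move=> i j; rewrite mxE dhomog0. Qed.

Lemma mxhomogN d p q (M : 'M_(p, q)) : mxhomog d M -> mxhomog d (- M).
Proof. by move=> Mh i j; rewrite mxE dhomogN. Qed.

Lemma mxhomog_row d p q r (M : 'M_(p, q)) (N : 'M_(p, r)) :
  mxhomog d M -> mxhomog d N -> mxhomog d (row_mx M N).
Proof. by move=> Mh Nh i j; rewrite mxE; case: split. Qed.

Lemma mxhomog_col d p q r (M : 'M_(p, q)) (N : 'M_(r, q)) :
  mxhomog d M -> mxhomog d N -> mxhomog d (col_mx M N).
Proof. by move=> Mh Nh i j; rewrite mxE; case: split. Qed.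

Lemma mxhomogM d e p q r (M : 'M_(p, q)) (N : 'M_(q, r)) :
  mxhomog d M -> mxhomog e N -> mxhomog (d + e) (M *m N).
Proof.
by move=> Mh Nh i j; rewrite mxE; apply: rpred_sum => k _; apply: dhomogM.
Qed.

Lemma mxhomog_lift d p q r (M : 'M_(p, q)) (A : 'M_(r, q)) :
  mxhomog d M -> mxhomog d.+1 A -> (forall k, exists w, row k A = w *m M) ->
  exists2 B : 'M_(r, p), B *m M = A & mxhomog 1 B.
Proof.
move=> Mh Ah AM.
have /fin_all_exists[w wP] k : exists w : 'rV_p,
    w *m M = row k A /\ forall j, w 0 j \is 1.-homog.
  have [w Dw] := AM k.
  have [||w' Dw' w'h] := @homogeneous_lift _ _ _ _ M (fun=> d%:Z) (fun=> 0) d.+1%:Z w.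
  - by move=> i j; rewrite subr0; apply: Mh.
  - by move=> j; rewrite subr0 -Dw mxE; apply: Ah.
  exists w'; split=> [|j]; first by rewrite Dw'.
  by have := w'h j; rewrite (_ : _ - _ = 1%:Z) //; lia.
exists (\matrix_(k, j) w k 0 j); last by move=> k j; rewrite mxE; apply: (wP k).2.
apply/row_matrixP => k; rewrite row_mul -(wP k).1; congr (_ *m _).
by apply/rowP => j; rewrite !mxE.
Qed.

(** The shifts of [F] are left open; [linear_resolution_regularity] sets them to [d + i], and
    minimality follows since linear forms have no constant term. *)
Definition linear_resolution d J : Prop := exists F : free_complex K n,
  [/\ mxhomog d (fr_aug F), forall i, mxhomog 1 (fr_diff F i) & resolves F J].

Lemma linear_resolution_ext d J J' : (forall f, J f <-> J' f) ->
  linear_resolution d J -> linear_resolution d J'.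
Proof.
move=> JJ' [F [Fa Fd [Jim e0 eS]]]; exists F; split => //; split => // f.
by rewrite -JJ'.
Qed.

Lemma linear_resolution_regularity d J : nonzero_ideal J ->
  linear_resolution d J -> regularity J d%:Z.
Proof.
move=> [f Jf f0] [[r s a D] [/= Fa Fd [/= Jim e0 eS]]].
pose F' := @FreeComplex K n r (fun i _ => (d + i)%N%:Z) a D.
exists F'; split.
- split => //; last by move=> i k l; apply: (dhomog_nemf_coeff (Fd i k l)); rewrite /= mdeg0.
  split=> [k|i k l] /=; first by rewrite addn0; apply: Fa.
  by rewrite (_ : _ - _ = 1%:Z); [apply: Fd|lia].
- move=> i j; rewrite /betti -lt0n => /card_gt0P[k].
  by rewrite inE /= => /eqP <-; lia.
- exists 0%N, d%:Z; split; last by rewrite subr0.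
  have [v Dv] := (Jim f).1 Jf.
  have [k _ _] : exists2 k : 'I_(r 0%N), true & v 0 k * a k 0 <> 0.
    apply: NNPP => H; case/eqP: f0; rewrite Dv mxE big1 // => k _.
    by apply: NNPP => nz; apply: H; exists k.
  by rewrite /betti -lt0n; apply/card_gt0P; exists k; rewrite inE /= addn0.
Qed.

Lemma linear_resolution_zero d : linear_resolution d (fun f : R => f = 0).
Proof.
exists (@FreeComplex K n (fun=> 0%N) (fun _ _ => 0) 0 (fun _ => 0)).
split=> [||]; try by move=> *; apply: mxhomog0.
split=> [f|v|i v] /=.
- split=> [->|[v ->]]; last by rewrite mxE big_ord0.
  by exists 0; rewrite mxE big_ord0.
- split=> _; last by rewrite [v]thinmx0 mul0mx.
  by exists 0; apply/rowP => -[].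
- split=> _; last by rewrite [v]thinmx0 mul0mx.
  by exists 0; apply/rowP => -[].
Qed.

Lemma linear_resolution_unit : linear_resolution 0 (fun _ : R => True).
Proof.
exists (@FreeComplex K n (fun i => (i == 0)%N) (fun _ _ => 0) (1%:M : 'cV_1) (fun _ => 0)).
split=> [i j||]; try by move=> *; apply: mxhomog0.
  by rewrite mxE !ord1 eqxx; apply: dhomog1.
split=> [f|v|i v] /=.
- split=> // _; exists (f%:M : 'rV_1); by rewrite mulmx1 mxE eqxx.
- rewrite mulmx1; split=> [->|[w ->]]; last by rewrite mulmx0.
  by exists 0; rewrite mulmx0.
- by rewrite [v]thinmx0 mul0mx; split=> // _; exists 0; rewrite mul0mx.
Qed.

(** Dependent choice, for building a chain map one homological degree at a time. *)
Lemma dependent_chain (A : nat -> Type)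
    (P : forall i, A i -> A i.+1 -> Prop) (a0 : A 0%N) :
  (forall i a, exists b, P i a b) ->
  exists f : forall i, A i, f 0%N = a0 /\ forall i, P i (f i) (f i.+1).
Proof.
move=> H; pose g i a := constructive_indefinite_description _ (H i a).
exists (nat_rect A a0 (fun i a => sval (g i a))); split=> // i.
exact: (svalP (g i _)).
Qed.

End LinearComplexes.

(** * Mapping cones of linear resolutions *)

Section MappingCone.
Variables (K : fieldType) (n : nat).
Local Notation R := {mpoly K[n]}.
Variables (I P : R -> Prop) (d : nat) (x : R).
Hypothesis xh : x \is 1.-homog.
Hypothesis x0 : x != 0.
Hypothesis sIP : forall f, I f -> P f.
Hypothesis xI : forall f, I (x * f) -> I f.
Variables F G : free_complex K n.
Hypothesis (Fa : mxhomog d.+1 (fr_aug F)) (Fd : forall i, mxhomog 1 (fr_diff F i)).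
Hypothesis (Ga : mxhomog d (fr_aug G)) (Gd : forall i, mxhomog 1 (fr_diff G i)).
Hypothesis (FI : resolves F I) (GP : resolves G P).

Local Notation rF := (fr_rank F).
Local Notation rG := (fr_rank G).
Local Notation dF := (fr_diff F).
Local Notation dG := (fr_diff G).

Lemma diff_aug0 (H : free_complex K n) J : resolves H J ->
  fr_diff H 0 *m fr_aug H = 0.
Proof.
move=> [_ e0 _]; apply/row_matrixP => k; rewrite row_mul row0.
by apply/e0; exists (delta_mx 0 k); rewrite -rowE.
Qed.

Lemma diff_diff0 (H : free_complex K n) J i : resolves H J ->
  fr_diff H i.+1 *m fr_diff H i = 0.
Proof.
move=> [_ _ eS]; apply/row_matrixP => k; rewrite row_mul row0.
by apply: (eS _ _).2; exists (delta_mx 0 k); rewrite -rowE.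
Qed.

(** Comparison of resolutions over the inclusion of I in P; entries are linear because generators of
    I have degree one more than those of P. *)
Lemma exists_chain_map : exists phi : forall i, 'M[R]_(rF i, rG i),
  [/\ forall i, mxhomog 1 (phi i), phi 0%N *m fr_aug G = fr_aug F
    & forall i, phi i.+1 *m dG i = dF i *m phi i].
Proof.
pose good i (M : 'M[R]_(rF i, rG i)) :=
  mxhomog 1 M /\ forall k, exists w, row k (dF i *m M) = w *m dG i.
have [phi0 phi0a good0] : exists2 M : 'M[R]_(rF 0, rG 0),
    M *m fr_aug G = fr_aug F & good 0%N M.
  have [k|M Ma Mh] := mxhomog_lift Ga Fa.
    have [Gim _ _] := GP; have [Fim _ _] := FI.
    have /sIP/Gim[w Dw] : I (row k (fr_aug F) 0 0).
      by apply/Fim; exists (delta_mx 0 k); rewrite -rowE.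
    by exists w; apply/rowP => j; rewrite ord1 Dw.
  exists M => //; split=> // k; have [_ e0 _] := GP.
  by apply/e0; rewrite row_mul -mulmxA Ma -row_mul (diff_aug0 FI) row0.
have step i (M : {M | good i M}) : exists M' : {M' | good i.+1 M'},
    sval M' *m dG i = dF i *m sval M.
  case: M => M [Mh Mim] /=.
  have [|M' M'd M'h] := mxhomog_lift (@Gd i) _ Mim.
    exact: mxhomogM (@Fd i) Mh.
  suff gM' : good i.+1 M' by exists (exist _ M' gM').
  split=> // k; have [_ _ eS] := GP; apply: (eS _ _).1.
  by rewrite row_mul -mulmxA M'd mulmxA -row_mul (diff_diff0 _ FI) row0 mul0mx.
have [phi [phi0E phiS]] := dependent_chain (exist (good 0%N) _ good0) step.
exists (fun i => sval (phi i)); split=> // [i|]; first by case: (svalP (phi i)).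
by rewrite phi0E.
Qed.

Definition prev_rank i := if i is j.+1 then rF j else 0%N.

Definition prev_diff i : 'M[R]_(rF i, prev_rank i) :=
  if i is j.+1 return 'M[R]_(rF i, prev_rank i) then - dF j else 0.

Variable phi : forall i, 'M[R]_(rF i, rG i).
Hypothesis phih : forall i, mxhomog 1 (phi i).
Hypothesis phi_aug : phi 0%N *m fr_aug G = fr_aug F.
Hypothesis phi_diff : forall i, phi i.+1 *m dG i = dF i *m phi i.

(* The mapping cone of (x, - inclusion) : I(-1) -> I (+) P(-1), whose cokernel
   is I + x P. *)
Definition cone : free_complex K n :=
  @FreeComplex K n (fun i => rF i + (rG i + prev_rank i))%N (fun _ _ => 0)
    (col_mx (fr_aug F) (col_mx (x *: fr_aug G) 0))
    (fun i => col_mx (row_mx (dF i) 0)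
               (col_mx (row_mx 0 (row_mx (dG i) 0))
                       (row_mx (- x%:M) (row_mx (phi i) (prev_diff i))))).

Lemma cone_homog :
  mxhomog d.+1 (fr_aug cone) /\ forall i, mxhomog 1 (fr_diff cone i).
Proof.
split=> [|i].
  apply: mxhomog_col => //; apply: mxhomog_col; last exact: mxhomog0.
  by move=> i j; rewrite mxE -[d.+1]add1n; apply: dhomogM.
have H0 p q : mxhomog 1 (0 : 'M[R]_(p, q)) by apply: mxhomog0.
have xN p : mxhomog 1 (- x%:M : 'M[R]_p).
  by apply/mxhomogN => k l; rewrite mxE; case: eqP => _; rewrite ?mulr0n ?dhomog0.
have prevh : mxhomog 1 (prev_diff i).
  by case: (i) => [|j]; [apply: mxhomog0|apply/mxhomogN/Fd].
apply: mxhomog_col; first exact: mxhomog_row (@Fd i) (H0 _ _).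
apply: mxhomog_col.
  by apply: mxhomog_row (H0 _ _) _; apply: mxhomog_row (@Gd i) (H0 _ _).
by apply: mxhomog_row (xN _) _; apply: mxhomog_row (@phih i) prevh.
Qed.

Lemma cone_augE (a : 'rV_(rF 0)) (b : 'rV_(rG 0)) (c : 'rV_(prev_rank 0)) :
  row_mx a (row_mx b c) *m fr_aug cone = a *m fr_aug F + x *: (b *m fr_aug G).
Proof. by rewrite !mul_row_col mulmx0 addr0 -scalemxAr. Qed.

Lemma cone_diffE i (a : 'rV_(rF i.+1)) (b : 'rV_(rG i.+1)) (c : 'rV_(prev_rank i.+1)) :
  row_mx a (row_mx b c) *m fr_diff cone i =
  row_mx (a *m dF i - x *: c) (row_mx (b *m dG i + c *m phi i) (c *m prev_diff i)).
Proof.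
rewrite !mul_row_col !mul_mx_row !mulmx0 !add_row_mx !add0r.
by rewrite mulmxN mul_mx_scalar.
Qed.

(** By [sIP] and [xI] the intersection of I and xP is xI, so the relations between the summands of I
    + xP form a copy of I, resolved by the shifted [F]. *)
Lemma cone_resolves C :
  (forall f, C f <-> exists a b, [/\ I a, P b & f = a + x * b]) ->
  resolves cone C.
Proof.
move=> CE; have [Fim Fe0 FeS] := FI; have [Gim Ge0 GeS] := GP.
have rowE3 p q r (v : 'rV[R]_(p + (q + r))) :
    exists a b c, v = row_mx a (row_mx b c).
  by exists (lsubmx v), (lsubmx (rsubmx v)), (rsubmx (rsubmx v)); rewrite !hsubmxK.
split=> [f|v|i v].
- rewrite CE; split=> [[a [b [/Fim[v ->] /Gim[w ->] ->]]]|[v ->]].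
    by exists (row_mx v (row_mx w 0)); rewrite cone_augE !mxE.
  have [a [b [c ->]]] := rowE3 _ _ _ v; rewrite cone_augE.
  exists ((a *m fr_aug F) 0 0), ((b *m fr_aug G) 0 0).
  split; [by apply/Fim; exists a|by apply/Gim; exists b|by rewrite !mxE].
- have [a [b [c ->]]] := rowE3 _ _ _ v; rewrite cone_augE; split=> [E|[w]].
    have : I ((b *m fr_aug G) 0 0).
      apply: xI; apply/Fim; exists (- a); apply/eqP.
      have /rowP/(_ 0) := E; rewrite mulNmx !mxE => /eqP.
      by rewrite addrC addr_eq0.
    move=> /Fim[u Du].
    have {}Du : b *m fr_aug G = u *m fr_aug F by apply/rowP => j; rewrite ord1.
    have /Fe0[w1 Dw1] : (a + x *: u) *m fr_aug F = 0.
      by rewrite mulmxDl -scalemxAl -Du.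
    have /Ge0[w2 Dw2] : (b - u *m phi 0) *m fr_aug G = 0.
      by rewrite mulmxBl -mulmxA phi_aug Du subrr.
    exists (row_mx w1 (row_mx w2 u)); rewrite cone_diffE -Dw1 -Dw2 addrK subrK.
    by rewrite [c]thinmx0 [_ *m prev_diff 0]thinmx0.
  have [w1 [w2 [u ->]]] := rowE3 _ _ _ w; rewrite cone_diffE.
  move=> /eq_row_mx[-> /eq_row_mx[-> _]].
  rewrite mulmxBl mulmxDl -!mulmxA (diff_aug0 FI) (diff_aug0 GP) phi_aug !mulmx0.
  by rewrite !add0r -scalemxAl addNr.
- have [a [b [c ->]]] := rowE3 _ _ _ v; rewrite cone_diffE; split=> [E|[w]].
    have [Ea Eb Ec] : [/\ a *m dF i = x *: c, b *m dG i = - (c *m phi i)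
                        & c *m prev_diff i = 0].
      move: E; rewrite -[0]hsubmxK -[rsubmx 0]hsubmxK !linear0 => /eq_row_mx[Ea].
      move=> /eq_row_mx[Eb Ec]; split=> //; apply/eqP; first by rewrite -subr_eq0 Ea.
      by rewrite -addr_eq0 Eb.
    (* For positive [i], [c] is itself a cycle of [F]; for [i] = 0 the equation [Ea] shows that x
       kills the augmentation of [c], and x is nonzero. *)
    have [u Du] : exists u, c = u *m dF i.
      clear E; case: i v a b c Ea Eb Ec => [|i] _ a b c Ea _ Ec.
        apply/Fe0/eqP; have : x *: (c *m fr_aug F) == 0.
          by rewrite scalemxAl -Ea -mulmxA (diff_aug0 FI) mulmx0.
        by rewrite scalemx_eq0 (negPf x0).
      by apply: (FeS _ _).1; move/eqP: Ec; rewrite mulmxN oppr_eq0 => /eqP.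
    have [w1 Dw1] : exists w, a - x *: u = w *m dF i.+1.
      by apply: (FeS _ _).1; rewrite mulmxBl Ea -scalemxAl -Du subrr.
    have [w2 Dw2] : exists w, b + u *m phi i.+1 = w *m dG i.+1.
      by apply: (GeS _ _).1; rewrite mulmxDl Eb -mulmxA phi_diff mulmxA -Du addNr.
    exists (row_mx w1 (row_mx w2 (- u))); rewrite cone_diffE -Dw1 -Dw2.
    by rewrite scalerN opprK subrK mulNmx addrK mulNmx mulmxN opprK -Du.
  have [w1 [w2 [u ->]]] := rowE3 _ _ _ w; rewrite cone_diffE.
  move=> /eq_row_mx[-> /eq_row_mx[-> ->]].
  have -> : u *m prev_diff i.+1 = - (u *m dF i) by rewrite mulmxN.
  rewrite mulmxBl mulmxDl -!mulmxA (diff_diff0 i FI) (diff_diff0 i GP) phi_diff.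
  rewrite !mulmx0 !add0r -scalemxAl scalerN opprK addNr mulNmx mulmxA subrr.
  rewrite [X in row_mx _ (row_mx _ X)](_ : _ = 0) ?row_mx0 //.
  case: i u {v a b c w w1 w2} => [|i] u; first exact: thinmx0.
  by rewrite mulNmx mulmxN opprK -mulmxA (diff_diff0 i FI) mulmx0.
Qed.

End MappingCone.

Lemma linear_resolution_cone (K : fieldType) n (I P C : {mpoly K[n]} -> Prop) d
    (x : {mpoly K[n]}) :
  x \is 1.-homog -> x != 0 -> (forall f, I f -> P f) -> (forall f, I (x * f) -> I f) ->
  (forall f, C f <-> exists a b, [/\ I a, P b & f = a + x * b]) ->
  linear_resolution d.+1 I -> linear_resolution d P -> linear_resolution d.+1 C.
Proof.
move=> xh x0 sIP xI CE [F [Fa Fd FI]] [G [Ga Gd GP]].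
have [phi [phih phia phid]] := exists_chain_map sIP Fa Fd Ga Gd FI GP.
have [Ca Cd] := cone_homog xh Fa Fd Ga Gd phih.
by exists (cone x phi); split=> //; apply: (cone_resolves (I := I) (P := P)).
Qed.

(** * Linear resolutions of edge ideals *)

Section MonomialSpans.
Variables (K : fieldType) (n : nat).
Local Notation R := {mpoly K[n]}.
Implicit Types (A B C : pred 'X_{1..n}) (f : R).

Definition mspan A f : Prop := forall m, f@_m != 0 -> A m.

(** The cone construction read on exponents; stability of [A] under division by x_v expresses that
    x_v is a nonzerodivisor modulo its span. *)
Lemma linear_resolution_mspan_cone A B C v d :
  (forall m, A m -> B m) -> (forall m, A (m + U_(v))%MM -> A m) ->
  (forall m, C m = A m || ((m v != 0%N) && B (m - U_(v))%MM)) ->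
  linear_resolution d.+1 (mspan A) -> linear_resolution d (mspan B) ->
  linear_resolution d.+1 (mspan C).
Proof.
move=> AB Av CE; apply: (@linear_resolution_cone _ _ _ _ _ _ ('X_v : R)).
- by rewrite dhomogX /= mdeg1.
- by rewrite -msupp_eq0 msuppX.
- by move=> f Af m /Af/AB.
- by move=> f Af m; rewrite -(mcoeffXM v) => /Af/Av.
move=> f; split=> [Cf|[a [b [Aa Bb ->]]] m].
  exists (mpart A f), (mquo v (f - mpart A f)); split=> [m|m|].
  - by rewrite mcoeff_mpart; case: (A m); rewrite ?eqxx.
  - rewrite mcoeff_mquo mcoeffB mcoeff_mpart; case: ifP => [_|nA].
      by rewrite subrr eqxx.
    by rewrite subr0 => /Cf; rewrite CE nA addmK => /andP[].
  - rewrite -[LHS](subrK (mpart A f)) addrC; congr (_ + _).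
    rewrite [LHS](mpart_mquo v) [X in X + _](_ : _ = 0) ?add0r //.
    apply/mpolyP => m; rewrite mcoeff_mpart mcoeff0 mcoeffB mcoeff_mpart.
    case: ifP => // /eqP mv; case: ifP => [_|nA]; rewrite ?subrr // subr0.
    by apply/eqP/negPn/negP => /Cf; rewrite CE nA mv.
rewrite mcoeffD mcoeffXME CE; have [-> /=|am _] := eqVneq a@_m 0.
  rewrite add0r; case: (m v == 0%N) => /=; first by rewrite eqxx.
  by move=> /Bb ->; rewrite orbT.
by rewrite (Aa m am).
Qed.

(** Adding a variable is a cone with the unit ideal: (U) = (U - u) + x_u R. *)
Lemma linear_resolution_vars (U : {set 'I_n}) :
  linear_resolution 1 (mspan [pred m : 'X_{1..n} | [exists u in U, m u != 0%N]]).
Proof.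
have [k] := ubnP #|U|; elim: k U => // k IHk U lt_k.
have [->|/set0Pn[u uU]] := eqVneq U set0.
  apply: (linear_resolution_ext _ (linear_resolution_zero K n 1)) => f.
  split=> [->|f0]; first by move=> m; rewrite mcoeff0 eqxx.
  apply/mpolyP => m; rewrite mcoeff0; apply/eqP/negPn/negP => /f0 /exists_inP[u].
  by rewrite inE.
apply: (@linear_resolution_mspan_cone
  [pred m : 'X_{1..n} | [exists w in U :\ u, m w != 0%N]] predT _ u 0) => // [m|m||].
- move=> /exists_inP[w wU mw]; apply/exists_inP; exists w => //; move: mw.
  by move: wU; rewrite !inE mnmDE mnm1E eq_sym => /andP[/negPf-> _]; rewrite addn0.
- rewrite /= andbT; apply/exists_inP/orP => [[w wU mw]|[/exists_inP[w]|mu]].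
  + have [<-|wu] := eqVneq w u; [by right|left].
    by apply/exists_inP; exists w; rewrite // !inE wu.
  + by rewrite !inE => /andP[_ wU] mw; exists w.
  + by exists u.
- by apply: IHk; move: lt_k; rewrite (cardsD1 u U) uU.
- exact: (linear_resolution_ext _ (linear_resolution_unit K n)).
Qed.

Definition edge_exponent (e : rel 'I_n) (S : {set 'I_n}) : pred 'X_{1..n} :=
  fun m => [exists i in S, exists j in S, [&& e i j, m i != 0%N & m j != 0%N]].

Lemma edge_exponentP (e : rel 'I_n) (S : {set 'I_n}) (m : 'X_{1..n}) :
  reflect (exists i j, [/\ i \in S, j \in S, e i j, m i != 0%N & m j != 0%N])
          (edge_exponent e S m).
Proof.
apply: (iffP exists_inP) => [[i iS /exists_inP[j jS /and3P[]]]|[i [j [iS jS eij mi mj]]]].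
  by exists i, j.
by exists i => //; apply/exists_inP; exists j; rewrite // eij mi.
Qed.

Lemma linear_resolution_edges (e : rel 'I_n) (S : {set 'I_n}) :
  (forall u, e u u = false) -> (forall u v, e u v = e v u) ->
  (forall T : {set 'I_n}, T != set0 -> exists2 s, s \in T & simplicial e T s) ->
  linear_resolution 2 (mspan (edge_exponent e S)).
Proof.
move=> e_irr e_sym simp; have [k] := ubnP #|S|; elim: k S => // k IHk S lt_k.
have [->|/simp[v vS vsimp]] := eqVneq S set0.
  apply: (linear_resolution_ext _ (linear_resolution_zero K n 2)) => f.
  split=> [->|f0]; first by move=> m; rewrite mcoeff0 eqxx.
  apply/mpolyP => m; rewrite mcoeff0; apply/eqP/negPn/negP => /f0 /edge_exponentP.
  by move=> [i [j []]]; rewrite inE.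
pose U := [set u in S | e v u].
apply: (@linear_resolution_mspan_cone (edge_exponent e (S :\ v))
  [pred m : 'X_{1..n} | [exists u in U, m u != 0%N]] _ v 1) => [m|m|m||].
(* Simpliciality of [v] enters here: an edge avoiding [U] would join two complement neighbours of
   [v]. *)
- move=> /edge_exponentP[i [j []]]; rewrite !inE => /andP[iv iS] /andP[jv jS] eij mi mj.
  have [evi|evi] := boolP (e v i); first by apply/exists_inP; exists i; rewrite // inE iS.
  have [evj|evj] := boolP (e v j); first by apply/exists_inP; exists j; rewrite // inE jS.
  by have := vsimp i j iS jS iv jv evi evj; rewrite eij.
- move=> /edge_exponentP[i [j [iS jS eij mi mj]]]; apply/edge_exponentP; exists i, j.
  move: iS jS mi mj; rewrite !inE !mnmDE !mnm1E => /andP[iv iS] /andP[jv jS].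
  by rewrite ![v == _]eq_sym (negPf iv) (negPf jv) !addn0 => *; split; rewrite ?iS ?jS.
- have mU u : u != v -> (m - U_(v))%MM u = m u.
    by move=> uv; rewrite mnmBE mnm1E eq_sym (negPf uv) subn0.
  apply/edge_exponentP/orP => [[i [j [iS jS eij mi mj]]]|].
    have [E|iv] := eqVneq i v.
      have jv : j != v by apply: contraTneq eij => ->; rewrite E e_irr.
      right; rewrite -[X in m X]E mi; apply/exists_inP; exists j; rewrite ?mU //.
      by rewrite inE jS -E.
    have [E|jv] := eqVneq j v.
      right; rewrite -[X in m X]E mj; apply/exists_inP; exists i; rewrite ?mU //.
      by rewrite inE iS e_sym -E.
    by left; apply/edge_exponentP; exists i, j; rewrite !inE iv jv.
  case=> [/edge_exponentP[i [j []]]|/andP[mv /exists_inP[u]]].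
    by rewrite !inE => /andP[_ iS] /andP[_ jS] *; exists i, j.
  rewrite inE => /andP[uS evu] mu; exists v, u; split=> //.
  by rewrite -mU //; apply: contraTneq evu => ->; rewrite e_irr.
- by apply: IHk; move: lt_k; rewrite (cardsD1 v S) vS.
- exact: linear_resolution_vars.
Qed.

End MonomialSpans.

(** * The radical as an edge ideal *)

Section Radical.
Variables (K : fieldType) (n : nat).
Local Notation R := {mpoly K[n]}.
Implicit Types (f g : R) (m : 'X_{1..n}).

Lemma mspan_ideal (A : pred 'X_{1..n}) :
  (forall m m', A m -> A (m' + m)%MM) -> is_ideal (mspan (K := K) A).
Proof.
move=> Aup; split=> [m|f g Af Ag m|f g Ag m].
- by rewrite mcoeff0 eqxx.
- rewrite mcoeffD; have [->|/Af//] := eqVneq f@_m 0.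
  by rewrite add0r => /Ag.
- rewrite -mcoeff_msupp => /msuppM_le/allpairsP[[m1 m2] /= [_]].
  by rewrite mcoeff_msupp => /Ag Am2 ->; apply: Aup.
Qed.

Lemma mspan_graded (A : pred 'X_{1..n}) :
  (forall m m', A m -> A (m' + m)%MM) -> graded_ideal (mspan (K := K) A).
Proof.
move=> Aup; split; first exact: mspan_ideal.
move=> f d Af m; rewrite pihomog_mpart mcoeff_mpart.
by case: ifP => _; [apply: Af|rewrite eqxx].
Qed.

(** [A] behaves as a face of the exponent monoid: a product of monomials lands in [A] only if both
    factors do. *)
Lemma mpartM (A : pred 'X_{1..n}) f g :
  (forall m1 m2, A (m1 + m2)%MM = A m1 && A m2) ->
  mpart A (f * g) = mpart A f * mpart A g.
Proof.
move=> AM; apply/mpolyP => m; rewrite mcoeff_mpart !mcoeffM; case: ifP => Am.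
  apply: eq_bigr => /= -[k1 k2] /= /eqP E; rewrite !mcoeff_mpart.
  by have := AM k1 k2; rewrite -E Am => /esym/andP[-> ->].
rewrite big1 // => /= -[k1 k2] /= /eqP E; rewrite !mcoeff_mpart.
by have := AM k1 k2; rewrite -E Am; case: (A k1) => /= [<-|_]; rewrite ?mulr0 ?mul0r.
Qed.

Lemma radical_ideal (I : R -> Prop) : is_ideal I -> is_ideal (radical I).
Proof.
move=> Iid; have [I0 ID IM] := Iid; split.
- by exists 1%N; rewrite expr1.
- move=> f g [a Ia] [b Ib]; exists (a + b)%N; rewrite exprDn.
  apply: ideal_sum => // i _; rewrite -mulr_natl; apply: (IM).
  have [le_bi|lt_ib] := leqP b i.
    by rewrite -(subnK le_bi) exprD mulrA; apply: IM.
  have -> : (a + b - i = b - i + a)%N by lia.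
  by rewrite exprD mulrC mulrA; apply: IM.
- move=> f g [k Ik]; exists k; rewrite exprMn; exact: IM.
Qed.

Lemma edge_exponent_up (e : rel 'I_n) (S : {set 'I_n}) m m' :
  edge_exponent e S m -> edge_exponent e S (m' + m)%MM.
Proof.
move=> /edge_exponentP[i [j [iS jS eij mi mj]]]; apply/edge_exponentP.
by exists i, j; rewrite !mnmDE !addn_eq0 (negPf mi) (negPf mj) !andbF.
Qed.

Variable I : R -> Prop.
Hypothesis I2 : support_two_monomial_ideal I.

Let Imon : monomial_ideal I := proj1 I2.
Let Iid : is_ideal I := monomial_ideal_is_ideal Imon.

Local Notation A := (edge_exponent (edge I) [set: 'I_n]).

Lemma edge_of_mem m : I 'X_[m] -> A m.
Proof.
move=> /(support_two_le I2)[u [umin /mnm_lepP le_u u2]].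
have [i [j [ij Du]]] := cards2P _ (introT eqP u2).
have mu w : w \in [set i; j] -> m w != 0%N.
  by rewrite -Du inE -!lt0n => /leq_trans; apply.
apply/edge_exponentP; exists i, j; split; rewrite ?inE // ?mu ?inE ?eqxx ?orbT //.
apply/edgeP; split; [exact/eqP|by exists u].
Qed.

Lemma radical_support_two f : radical I f <-> mspan A f.
Proof.
split=> [[k Ifk] m fm|Af]; last first.
  have Rid := radical_ideal Iid.
  rewrite (mpolyE f); apply: ideal_sum => // m; rewrite mcoeff_msupp => /Af.
  move=> /edge_exponentP[i [j [_ _ eij mi mj]]]; apply: idealZ => //.
  have [k Ik] := edge_power I2; exists k; rewrite mpolyXn.
  apply: (ideal_monomial_le Iid (Ik i j eij)); apply/mnm_lepP => w.
  rewrite !mulmnE leq_mul2r mnmDE !mnm1E; apply/orP; right.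
  have ij : i != j by apply: contraTneq eij => ->; rewrite edge_irrefl.
  have [<-|iw] := eqVneq i w; first by rewrite eq_sym (negPf ij) lt0n.
  by have [<-|] := eqVneq j w; rewrite ?lt0n.
have [//|nAm] := boolP (A m); exfalso.
(* The monomials whose support lies in the independent set supp(m) span a
   quotient of R by a prime containing I. *)
pose B := [pred m' : 'X_{1..n} | [forall w, (m w == 0%N) ==> (m' w == 0%N)]].
have BM m1 m2 : B (m1 + m2)%MM = B m1 && B m2.
  apply/forallP/andP => [H|[/forallP H1 /forallP H2] w]; last first.
    by apply/implyP => mw; rewrite mnmDE addn_eq0 (implyP (H1 w)) ?(implyP (H2 w)).
  by split; apply/forallP => w; apply/implyP => /(implyP (H w));
    rewrite mnmDE addn_eq0 => /andP[].
have nAB m' : A m' -> ~~ B m'.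
  move=> /edge_exponentP[i [j [iS jS eij mi mj]]]; apply: contra nAm => /forallP H.
  apply/edge_exponentP; exists i, j; split=> //.
    by apply: contraNN mi => /(implyP (H i)).
  by apply: contraNN mj => /(implyP (H j)).
have B0 : B 0%MM by apply/forallP => w; rewrite mnm0E eqxx implybT.
have mpartX j : mpart B (f ^+ j) = mpart B f ^+ j.
  elim: j => [|j IHj]; last by rewrite !exprS (mpartM _ _ BM) IHj.
  apply/mpolyP => m'; rewrite mcoeff_mpart expr0 mcoeff1.
  by have [->|_] := eqVneq m' 0%MM; rewrite ?B0 ?if_same.
(* The projection kills I and commutes with powers, so [mpart B f] is nilpotent, hence 0, although
   it retains the monomial [m]. *)
have : mpart B f ^+ k == 0.
  rewrite -mpartX; apply/eqP/mpolyP => m'; rewrite mcoeff_mpart mcoeff0.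
  case: ifP => // Bm'; apply/eqP/negPn/negP => /(monomial_idealP Imon _).1.
  by move=> /(_ Ifk)/edge_of_mem/nAB; rewrite Bm'.
rewrite expf_eq0 => /andP[_ /eqP/mpolyP/(_ m)].
rewrite mcoeff_mpart mcoeff0 (_ : B m); first by move/eqP: fm.
by apply/forallP => w; apply/implyP.
Qed.

Lemma radical_linear_resolution (Icl : componentwise_linear I) :
  nonzero_ideal I -> has_linear_resolution (radical I).
Proof.
move=> [f0 If0 f00].
have -> : radical I = mspan A.
  apply: functional_extensionality => f; apply: propositional_extensionality.
  exact: radical_support_two.
have nzA : nonzero_ideal (mspan (K := K) A).
  by exists f0 => //; apply/radical_support_two; exists 1%N; rewrite expr1.
have linA : linear_resolution 2 (mspan (K := K) A).
  apply: linear_resolution_edges => [u|u v|T T0].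
  - exact: edge_irrefl.
  - exact: edge_sym.
  - apply: (@exists_simplicial K _ (edge I)) => // [u|u v|].
    + exact: edge_irrefl.
    + exact: edge_sym.
    + by move=> *; apply: bridge.
split=> //; first by apply: mspan_graded => *; apply: edge_exponent_up.
exists 2%N; last exact: linear_resolution_regularity.
split.
  have [m /edge_exponentP[i [j [_ _ eij _ _]]]] : exists m, A m.
    have [m f0m] : exists m, f0@_m != 0.
      apply: NNPP => H; case/eqP: f00; apply/mpolyP => m; rewrite mcoeff0.
      by apply/eqP/negPn/negP => f0m; apply: H; exists m.
    by exists m; apply/edge_of_mem/((monomial_idealP Imon f0).1 If0).
  exists 'X_[U_(i) + U_(j)]; split.
  - move=> m'; rewrite mcoeffX; have [<- _|_] := eqVneq (U_(i) + U_(j))%MM m'; last first.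
      by rewrite eqxx.
    apply/edge_exponentP; exists i, j; rewrite !inE; split=> //.
      by rewrite mnmDE !mnm1E eqxx.
    by rewrite mnmDE !mnm1E eqxx addnC.
  - by rewrite -msupp_eq0 msuppX.
  - by rewrite dhomogX /= mdegD !mdeg1.
move=> f d Af f_neq0 fd.
(* The leading monomial involves two distinct variables, which bounds the degree below by 2. *)
have lead := mlead_supp f_neq0; have <- := dhomog_mf fd lead.
have /Af/edge_exponentP[i [j [_ _ eij mi mj]]] : f@_(mlead f) != 0.
  by rewrite -mcoeff_msupp.
have ij : j != i by apply: contraTneq eij => ->; rewrite edge_irrefl.
rewrite /= mdegE (bigD1 i) //= (bigD1 j) //=; lia.
Qed.

End Radical.

Theorem theorem3p8 (K : fieldType) (n : nat) (I : {mpoly K[n]} -> Prop)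
    (hI : support_two_monomial_ideal I) (hcl : componentwise_linear I) :
  chordal (graph_compl (base_graph I)) /\
  (nonzero_ideal I -> has_linear_resolution (radical I)).
Proof.
split; first exact: complement_chordal.
exact: radical_linear_resolution.
Qed.
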